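(* Let $k\ge1$ be an integer and let $F\in V_k\Lambda^2(K)$ be a polynomial 2-form for which all the degrees of freedom $\Sigma^{k,2}(K)$ vanish. Then $F\equiv0$.
   Context: $K\subset\mathbb R^4$ is the pentatope (4-simplex) with vertices $(0,0,0,0),(1,0,0,0),(0,1,0,0),(0,0,1,0),(0,0,0,1)$; it has 10 triangular faces and 5 tetrahedral facets. $P^j$ denotes polynomials of total degree $\le j$ on the indicated set ($\{0\}$ if $j<0$), $\tilde P^k$ homogeneous polynomials of degree exactly $k$ (together with $0$). $\mathcal L:\mathbb R^6\to\mathbb K$ is the linear bijection onto the real skew-symmetric $4\times4$ matrices sending $(w_{12},w_{13},w_{14},w_{23},w_{24},w_{34})$ to the skew-symmetric matrix with those upper-triangular entries. The space is $$V_k\Lambda^2(K)=\mathcal L\big((P^{k-1}(K))^6\big)\oplus\{B\in\mathcal L\big((\tilde P^k(K))^6\big): B(x)x=0\}.$$ With $\varepsilon$ the Levi-Civita symbol, $[n\times F]_i=\sum_{j,k,l}\varepsilon_{ijkl}n_jF_{kl}$ for a vector $n$ and skew matrix $F$. If $n$ is the unit normal of a facet $\mathcal F$, then $n\times F$ is tangent to $\mathcal F$. For matrices $A:B=\sum_{i,j}A_{ij}B_{ij}$. Degrees of freedom $\Sigma^{k,2}(K)$ of $F$: - $\int_f\big((n\times F)\cdot\nu\big)q$, $q\in P^{k-1}(f)$, for each triangular face $f$, where $n$ is the unit normal of a facet $\mathcal F\supset f$ and $\nu$ is the unit normal to $f$ within $\mathcal F$ (the choice of $\mathcal F$ only affects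 the sign); - $\int_{\mathcal F}(n\times F)\cdot q$ for each tetrahedral facet $\mathcal F$ and each vector field $q$ tangent to $\mathcal F$ with components in $P^{k-2}(\mathcal F)$; - $\int_KF:q$, $q\in\mathcal L\big((P^{k-3}(K))^6\big)$. *)

(* Defs.v *)
From HB Require Import structures.
From mathcomp Require Import all_boot all_order all_algebra.
From mathcomp Require Import all_fingroup.
From mathcomp Require Import all_classical all_reals all_analysis.
From mathcomp Require Import -(notations) mpoly.

Set Implicit Arguments.
Unset Strict Implicit.
Unset Printing Implicit Defensive.

Import Order.TTheory GRing.Theory Num.Theory.
Local Open Scope ring_scope.

(* The notations of mpoly clash with those of MathComp-Analysis, hence the
   import without them; [polyR4 R] is {mpoly R[4]}. *)
Notation polyR4 R := (mpoly.mpoly 4 R).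

(* All polynomial spaces on K, on a facet or on a face are represented by
   polynomials in the four coordinates of the ambient space, restricted to the
   set in question. [mpoly.mmeasure mpoly.mdeg p] is the library's [msize p],
   i.e. 1 + total degree, and 0 for p = 0. *)
Definition in_P (R : realType) (j : int) (p : polyR4 R) : Prop :=
  p = 0 \/ ((mpoly.mmeasure mpoly.mdeg p)%:Z <= j + 1)%R.

Definition in_Phom (R : realType) (k : nat) (p : polyR4 R) : Prop :=
  p \is mpoly.ishomog1 k mpoly.mdeg.

Definition ev (R : realType) (m n : nat) (A : 'M[polyR4 R]_(m, n))
    (x : 'cV[R]_4) : 'M[R]_(m, n) :=
  \matrix_(i, j) mpoly.meval (fun l => x l 0) (A i j).

Definition dot (R : realType) (n : nat) (u v : 'cV[R]_n) : R :=
  \sum_i u i 0 * v i 0.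

Definition ddot (R : realType) (A B : 'M[R]_4) : R :=
  \sum_i \sum_j A i j * B i j.

(* The coordinates (w12, w13, w14, w23, w24, w34) are numbered 0, ..., 5. *)
Definition skewL (A : zmodType) (w : 'rV[A]_6) : 'M[A]_4 :=
  let c l := w 0 (inord l) in
  \matrix_(i < 4, j < 4) nth 0 (nth [::]
    [:: [::     0;   c 0;   c 1;  c 2];
        [:: - c 0;     0;   c 3;  c 4];
        [:: - c 1; - c 3;     0;  c 5];
        [:: - c 2; - c 4; - c 5;    0]] i) j.

(* At most one permutation contributes, namely (0,1,2,3) |-> (i,j,k,l). *)
Definition levi_civita (R : realType) (i j k l : 'I_4) : R :=
  \sum_(s : 'S_4 | [forall a, s a == tnth [tuple i; j; k; l] a]) (-1) ^+ s.

Definition cross (R : realType) (n : 'cV[R]_4) (F : 'M[R]_4) : 'cV[R]_4 :=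
  \col_i \sum_j \sum_k \sum_l levi_civita R i j k l * n j 0 * F k l.

(* Vertex 0 is the origin and vertex i > 0 is the i-th unit vector. A face of
   the pentatope is given by the set of indices of its vertices. *)
Definition vtx (R : realType) (i : 'I_5) : 'cV[R]_4 :=
  \col_j (i == j.+1 :> nat)%:R.

Definition is_triangle (f : {set 'I_5}) : Prop := #|f| = 3%N.
Definition is_facet (S : {set 'I_5}) : Prop := #|S| = 4%N.

Definition on_face (R : realType) (S : {set 'I_5}) (x : 'cV[R]_4) : Prop :=
  exists c : 'I_5 -> R,
    [/\ forall i, 0 <= c i, \sum_(i in S) c i = 1
      & x = \sum_(i in S) c i *: vtx R i].

Definition in_K (R : realType) (x : 'cV[R]_4) : Prop := on_face [set: 'I_5] x.

Definition tangent (R : realType) (S : {set 'I_5}) (u : 'cV[R]_4) : Prop :=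
  exists c : 'I_5 -> R,
    \sum_(i in S) c i = 0 /\ u = \sum_(i in S) c i *: vtx R i.

Definition unit_normal (R : realType) (S : {set 'I_5}) (n : 'cV[R]_4) : Prop :=
  dot n n = 1 /\ forall u, tangent S u -> dot n u = 0.

(* Lebesgue integral of g over {y | y_i >= 0, y_1 + ... + y_d <= t}, written as
   an iterated integral. *)
Fixpoint std_simplex_integral (R : realType) (d : nat) (t : R) :
    ('cV[R]_d -> R) -> R :=
  match d return ('cV[R]_d -> R) -> R with
  | 0 => fun g => g 0
  | d'.+1 => fun g =>
      \int[@lebesgue_measure R]_(x in `[0, t]%classic)
        std_simplex_integral (t - x)
          (fun y : 'cV[R]_d' => g (col_mx (x%:M : 'cV_1) y))
  end.

(* Integral over the convex hull of v_0, ..., v_d with respect to the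
   d-dimensional surface measure: affine parametrization by the standard
   simplex and square root of the Gram determinant. *)
Definition simplex_integral (R : realType) (d : nat) (v : 'I_d.+1 -> 'cV[R]_4)
    (g : 'cV[R]_4 -> R) : R :=
  let E : 'M[R]_(4, d) := \matrix_(i, j) (v (lift ord0 j) - v ord0) i 0 in
  Num.sqrt (\det (E^T *m E))
    * std_simplex_integral 1 (fun y => g (v ord0 + E *m y)).

(* S is meant to have d + 1 elements, which are listed in increasing order. *)
Definition face_integral (R : realType) (d : nat) (S : {set 'I_5})
    (g : 'cV[R]_4 -> R) : R :=
  simplex_integral (fun j : 'I_d.+1 => vtx R (nth ord0 (enum S) j)) g.

Definition in_VkL2 (R : realType) (k : nat) (F : 'M[polyR4 R]_4) : Prop :=
  exists u w : 'rV[polyR4 R]_6,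
    [/\ forall i, in_P (k%:Z - 1) (u 0 i),
        forall i, in_Phom k (w 0 i),
        forall x, in_K x -> ev (skewL w) x *m x = 0
      & F = skewL u + skewL w].

(* The choices on which the degrees of freedom depend up to sign: a unit normal
   for every facet S, and, for every triangle f, a facet containing f and a unit
   normal to f within that facet. *)
Record orientation (R : realType) := Orientation {
  nrm : {set 'I_5} -> 'cV[R]_4;
  fct : {set 'I_5} -> {set 'I_5};
  conrm : {set 'I_5} -> 'cV[R]_4;
  nrmP : forall S, is_facet S -> unit_normal S (nrm S);
  fctP : forall f, is_triangle f -> is_facet (fct f) /\ f \subset fct f;
  conrmP : forall f, is_triangle f ->
    tangent (fct f) (conrm f) /\ unit_normal f (conrm f)
}.

Definition dofs_vanish (R : realType) (k : nat) (o : orientation R)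
    (F : 'M[polyR4 R]_4) : Prop :=
  [/\ forall f, is_triangle f ->
        forall q : polyR4 R, in_P (k%:Z - 1) q ->
        face_integral 2 f (fun x =>
          dot (cross (nrm o (fct o f)) (ev F x)) (conrm o f)
            * mpoly.meval (fun l => x l 0) q) = 0,
      forall S, is_facet S ->
        forall q : 'cV[polyR4 R]_4, (forall i, in_P (k%:Z - 2) (q i 0)) ->
        (forall x, on_face S x -> tangent S (ev q x)) ->
        face_integral 3 S (fun x =>
          dot (cross (nrm o S) (ev F x)) (ev q x)) = 0
    & forall q : 'rV[polyR4 R]_6, (forall i, in_P (k%:Z - 3) (q 0 i)) ->
        face_integral 4 [set: 'I_5] (fun x =>
          ddot (ev F x) (ev (skewL q) x)) = 0].

(* Main.v *)
Require Import Defs.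
From HB Require Import structures.
From mathcomp Require Import all_boot all_order all_algebra.
From mathcomp Require Import all_fingroup.
From mathcomp Require Import all_classical all_reals all_analysis.
From mathcomp Require Import -(notations) ssrcomplements mpoly.
From mathcomp Require Import ring lra zify.

(** The matrix F stands for the 2-form with coefficients F k l, and the space
V_k is the space of polynomial 2-forms F of degree at most k whose contraction
F(x) x with the position vector has degree at most k as well, one less than
what the degree of F alone would give. In this form the condition is stable
under affine substitutions, so it passes to the pullback of F to any face.

The argument climbs the skeleton of the pentatope. If n is normal to a facet and
q is tangent to it, then (n x F) . q is, up to a nonzero constant, the wedge of
the pullback of F to that facet with the covector of q; likewise
(n x F) . nu is a nonzero multiple of the single coefficient of the pullback of
F to a triangle. This is the transformation law of the Levi-Civita symbol in an
orthonormally completed frame of the face ([cross_form_frame]).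

On a triangle the pullback has one coefficient, of degree at most k - 1, which
may be taken as its own test function: its square integrates to 0, so it
vanishes ([triangle_trace_free]). On a facet, with coordinates y in the standard
tetrahedron, the pullback is a vector field g which is tangential at the whole
boundary by the step on triangles. Integrating by parts against div g, which
has degree at most k - 1, turns the moments of g against gradients into the
integral of (div g)^2; hence div g = 0. Euler's identity then drops the degree
of g to k - 1, so that g_i = y_i a_i with a_i of degree at most k - 2, and
testing with the a_i makes the integral of the sum of y_i a_i^2 vanish
([flux_field_eq0]). In the interior the same three steps are made with the rows
of the Hodge dual H of F, which are tangential vector fields: the divergence of
row l is x_l e_l and testing with the differential of the 1-form e kills it;
so F is closed, its degree drops, and H_li = x_l x_i a_li with a_li of degree at
most k - 3, which are the last test functions ([bubble_form_eq0]).

All integrals are of polynomials over standard simplices, where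
y^m has integral m! / (d + |m|)! ([std_simplex_integral_moment]). Integration by
parts is an identity between such numbers ([moment_div_eq0]); positivity is
the only property for which the iterated integral itself is used
([std_simplex_integral_ge0]). *)

Set Implicit Arguments.
Unset Strict Implicit.
Unset Printing Implicit Defensive.
Import Order.TTheory GRing.Theory Num.Theory.
Local Open Scope ring_scope.
Local Notation "''X_' i" := (@mpolyX _ _ (mnm1 i))
  (at level 8, i at level 2, format "''X_' i").
Local Notation "{ 'mpoly' R [ n ] }" := (mpoly n R)
  (at level 0, R, n at level 2, format "{ 'mpoly'  R [ n ] }").
Local Notation msize p := (mmeasure mdeg p).

(** * Polynomials: degree and zeros *)

Section PolyDegree.
Variables (R : realFieldType) (n : nat).
Implicit Types (p q : {mpoly R[n]}) (m : multinom n).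

Lemma msize_leP p k :
  (forall m, (k <= mdeg m)%N -> mcoeff m p = 0) -> (msize p <= k)%N.
Proof.
move=> H; rewrite msizeE; apply/bigmax_leqP_seq => m mp _.
by apply: contraTltn mp => /H pm0; rewrite -mcoeff_eq0 pm0 eqxx.
Qed.

Lemma mcoeff_high p k m : (msize p <= k)%N -> (k <= mdeg m)%N -> mcoeff m p = 0.
Proof.
by move=> pk km; apply/memN_msupp_eq0/msize_mdeg_ge/(leq_trans pk).
Qed.

Lemma msizeD_leq p q k :
  (msize p <= k)%N -> (msize q <= k)%N -> (msize (p + q) <= k)%N.
Proof.
move=> pk qk; apply: msize_leP => m km.
by rewrite mcoeffD (mcoeff_high pk km) (mcoeff_high qk km) addr0.
Qed.

Lemma msizeB_leq p q k :
  (msize p <= k)%N -> (msize q <= k)%N -> (msize (p - q) <= k)%N.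
Proof. by move=> pk qk; apply: msizeD_leq; rewrite ?msizeN. Qed.

Lemma msizeZ_leq c p k : (msize p <= k)%N -> (msize (c *: p) <= k)%N.
Proof. by move=> pk; apply: leq_trans (msizeZ_le _ _) pk. Qed.

Lemma msize_sum_leq (I : Type) (r : seq I) (P : pred I) (F : I -> {mpoly R[n]}) k :
  (forall i, P i -> (msize (F i) <= k)%N) ->
  (msize (\sum_(i <- r | P i) F i) <= k)%N.
Proof.
move=> H; elim/big_rec: _ => [|i p Pi pk]; first by rewrite msize0.
by apply: msizeD_leq (H _ Pi) pk.
Qed.

Lemma msizeM_leq p q : (msize (p * q) <= (msize p + msize q).-1)%N.
Proof.
have [->|p0] := eqVneq p 0; first by rewrite mul0r msize0.
have [->|q0] := eqVneq q 0; first by rewrite mulr0 msize0.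
by rewrite msizeM.
Qed.

Lemma msizeMX_leq p i k : (msize p <= k)%N -> (msize ('X_i * p) <= k.+1)%N.
Proof.
move=> pk; apply: leq_trans (msizeM_leq _ _) _.
by rewrite msizeX mdeg1 add2n /= ltnS.
Qed.

(** Dividing by a variable lowers the degree by one; the test functions below
are quotients of this kind, which is how their degrees fit the spaces. *)
Lemma msizeMX_ge p i k : (msize ('X_i * p) <= k.+1)%N -> (msize p <= k)%N.
Proof.
have [->|p0] := eqVneq p 0; first by rewrite msize0.
rewrite msizeM ?msizeX ?mdeg1 //.
by rewrite -msize_poly_eq0 msizeX.
Qed.

Lemma msize_mderiv p i k : (msize p <= k.+1)%N -> (msize (mderiv i p) <= k)%N.
Proof.
move=> pk; apply: msize_leP => m km.
by rewrite mcoeff_deriv (mcoeff_high pk) ?mul0rn // mdegD mdeg1 addn1 ltnS.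
Qed.

Lemma mcoeff_Euler p m :
  mcoeff m (\sum_i 'X_i * mderiv i p) = (mdeg m)%:R * mcoeff m p.
Proof.
have XD i : mcoeff m ('X_i * mderiv i p) = (m i)%:R * mcoeff m p.
  have [mi0|mi0] := eqVneq (m i) 0%N.
    rewrite mi0 mul0r mcoeffM big1 // => -[m1 m2] /= /eqP mE.
    rewrite mcoeffX; case: eqP => [m1E|]; last by rewrite mul0r.
    have := congr1 (fun m' : multinom n => m' i) mE.
    by rewrite /= mnmDE -m1E mnm1E eqxx mi0.
  have mE : m = mnm_add (mnm1 i) (mnm_sub m (mnm1 i)).
    by rewrite addmC submK // lep1mP.
  rewrite {1}mE [X in mcoeff _ X]mulrC mcoeffMX mcoeff_deriv addmC -mE.
  by rewrite mnmBE mnm1E eqxx subn1 prednK ?lt0n // mulr_natl.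
rewrite raddf_sum /= (eq_bigr _ (fun i _ => XD i)) -mulr_suml -natr_sum.
by rewrite mdegE.
Qed.

(** The Euler operator E is diagonal in the monomial basis; the eigenvalues |m| + c
of E + c are positive, so no degree is lost. *)
Lemma msize_Euler p (c k : nat) : (0 < c)%N ->
  (msize (\sum_i 'X_i * mderiv i p + c%:R *: p) <= k)%N -> (msize p <= k)%N.
Proof.
move=> c0 H; apply: msize_leP => m km; move: (mcoeff_high H km).
rewrite mcoeffD mcoeff_Euler mcoeffZ -mulrDl -natrD => /eqP.
by rewrite mulf_eq0 pnatr_eq0 addn_eq0 (gtn_eqF c0) andbF => /eqP.
Qed.

End PolyDegree.

Lemma msize_comp (R : realFieldType) (n d : nat) (lq : n.-tuple {mpoly R[d]}) p k :
  (forall i, msize (tnth lq i) <= 2)%N -> (msize p <= k)%N ->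
  (msize (comp_mpoly lq p) <= k)%N.
Proof.
move=> lq2 pk; rewrite comp_mpolyEX.
rewrite big_seq; apply: msize_sum_leq => m mp; apply: msizeZ_leq.
have mk := leq_trans (msize_mdeg_lt mp) pk; apply: leq_trans mk.
have bnd (q a : {mpoly R[d]}) b : (msize q <= 2)%N -> (msize a <= b.+1)%N ->
    (msize (q * a) <= b.+2)%N.
  move=> q2 ab; apply: leq_trans (msizeM_leq _ _) _.
  by move: q2 ab; case: (msize q) (msize a) => [|[|[|?]]] [|?] //=; lia.
rewrite comp_mpolyX mdegE.
elim/big_rec2: _ => [|i b q _ qb]; first by rewrite msize1.
elim: (m i) => [|e IH]; first by rewrite expr0 mul1r add0n.
by rewrite exprS -mulrA addSn; apply: bnd.
Qed.

(** The points e / 2, e / 3, ... are more roots than the degree allows. *)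
Lemma poly_inf_roots (R : realFieldType) (h : {poly R}) (e : R) :
  0 < e -> (forall t, 0 < t < e -> h.[t] = 0) -> h = 0.
Proof.
move=> e0 H; apply: contraTeq isT => h0 /=.
pose rs := [seq e / k.+2%:R | k <- iota 0 (size h)].
have rt : all (root h) rs.
  apply/allP => _ /mapP [k _ ->]; apply/rootP/H.
  rewrite divr_gt0 ?ltr0n //= ltr_pdivrMr ?ltr0n //.
  by rewrite ltr_pMr // ltr1n.
have urs : uniq rs.
  rewrite map_inj_uniq ?iota_uniq // => i j /(mulfI (lt0r_neq0 e0)) /invr_inj /eqP.
  by rewrite eqr_nat => /eqP [].
by have := max_poly_roots h0 rt urs; rewrite size_map size_iota ltnn.
Qed.

(** A monomial is determined by its exponent in the last variable together with
its remaining exponents, so each coefficient of p can be read off [muni p]. *)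
Lemma muni_eq0 (R : realFieldType) n (p : {mpoly R[n.+1]}) : muni p = 0 -> p = 0.
Proof.
move=> p0; apply/mpolyP => m; rewrite mcoeff0.
pose low (m' : multinom n.+1) : multinom n :=
  Multinom [tuple m' (widen_ord (leqnSn n) i) | i < n].
have low_inj m' : low m' = low m -> m' ord_max = m ord_max -> m' = m.
  move=> lE mE; apply/mnmP => i; case: (unliftP ord_max i) => [j ->|-> //].
  have := congr1 (fun l : multinom n => l j) lE.
  rewrite !multinomE !tnth_mktuple.
  have -> // : widen_ord (leqnSn n) j = lift ord_max j.
  by apply/val_inj; rewrite /= /bump leqNgt ltn_ord.
have := congr1 (fun h : {poly {mpoly R[n]}} => mcoeff (low m) h`_(m ord_max)) p0.
rewrite muniE coef0 mcoeff0 coef_sum raddf_sum /= => H.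
rewrite -[RHS]H [in LHS](mpolyE p) raddf_sum /=; apply: eq_bigr => m' _.
rewrite coefZ coefXn mcoeffZ mcoeffX.
have [->|ne] := eqVneq m' m; first by rewrite !eqxx !mulr1 mcoeffZ mcoeffX eqxx mulr1.
case: eqP => [mE|_]; last by rewrite !mulr0 mcoeff0.
rewrite mulr1 mcoeffZ mcoeffX; case: eqP => // lE.
by rewrite (low_inj m' lE) ?eqxx in ne.
Qed.

Lemma meval_muni (R : realFieldType) n (p : {mpoly R[n.+1]}) (x : 'I_n -> R) t :
  (map_poly (meval x) (muni p)).[t]
  = meval (fun i => if unlift ord_max i is Some j then x j else t) p.
Proof.
rewrite muniE raddf_sum horner_sum mevalE; apply: eq_bigr => m _.
rewrite /= map_polyZ /= map_polyXn hornerZ hornerXn mevalZ mevalX -mulrA.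
congr (_ * _); rewrite big_ord_recr /= unlift_none; congr (_ * _).
apply: eq_bigr => j _; rewrite multinomE tnth_mktuple.
have -> : widen_ord (leqnSn n) j = lift ord_max j.
  by apply/val_inj; rewrite /= /bump leqNgt ltn_ord.
by rewrite liftK.
Qed.

(** Freeze all variables but the last: the univariate polynomial obtained has
infinitely many roots, so its coefficients vanish on a box of lower dimension. *)
Lemma meval_box_eq0 (R : realFieldType) n (p : {mpoly R[n]}) (e : R) : 0 < e ->
  (forall x, (forall i, 0 < x i < e) -> meval x p = 0) -> p = 0.
Proof.
move=> e0; elim: n p => [|n IH] p H.
  have : meval (fun=> 0) p = 0 by apply: H; case.
  by rewrite -(mpolyKC p) mevalC => ->; rewrite mpolyC0.
apply/muni_eq0/polyP => k; rewrite coef0; apply: IH => x Hx.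
have : map_poly (meval x) (muni p) = 0.
  apply: (poly_inf_roots e0) => t Ht; rewrite meval_muni; apply: H => i.
  by case: (unlift _ _).
by move/(congr1 (fun h : {poly R} => h`_k)); rewrite coef_map coef0.
Qed.

(** * Divisibility, moments of monomials and integration by parts *)

Lemma meval_col (R : realFieldType) n (x : 'I_n -> R) (p : {mpoly R[n]}) :
  meval x p = meval (fun l => (\col_i x i) l 0) p.
Proof. by apply: meval_eq => l; rewrite mxE. Qed.

(** The monomials free of X_i add up to a polynomial that ignores x_i, hence has
the values of p on the hyperplane x_i = 0. Restricting the other coordinates to
the unit interval makes room for a second division: a quotient by X_l is only
known to vanish at points of x_i = 0 where x_l is nonzero. *)
Lemma mpolyX_dvd (R : realFieldType) n (i : 'I_n) (p : {mpoly R[n]}) :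
  (forall x, x i = 0 -> (forall j, j != i -> 0 < x j < 1) -> meval x p = 0) ->
  exists a, p = 'X_i * a.
Proof.
move=> H.
pose a := \sum_(m <- msupp p | m i != 0%N) mcoeff m p *: mpolyX R (mnm_sub m (mnm1 i)).
pose r := \sum_(m <- msupp p | ~~ (m i != 0%N)) mcoeff m p *: mpolyX R m.
have pE : p = 'X_i * a + r.
  rewrite [LHS]mpolyE (bigID (fun m : multinom n => m i != 0%N)) /=.
  congr (_ + _); rewrite mulr_sumr; apply: eq_bigr => m mi0.
  by rewrite -scalerAr -mpolyXD addmC submK // lep1mP.
suff r0 : r = 0 by exists a; rewrite {1}pE r0 addr0.
apply: (meval_box_eq0 (ltr01)) => x Hx.
pose x' j := if j == i then 0 else x j.
have -> : meval x r = meval x' r.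
  rewrite !raddf_sum; apply: eq_bigr => m; rewrite negbK => /eqP mi0 /=.
  rewrite !mevalZ !mevalX; congr (_ * _); apply: eq_bigr => j _.
  by rewrite /x'; case: eqP => // ->; rewrite mi0 !expr0.
have x'i : x' i = 0 by rewrite /x' eqxx.
have := H x' x'i; rewrite pE mevalD mevalM mevalXU x'i mul0r add0r; apply.
by move=> j /negbTE ji; rewrite /x' ji.
Qed.

(** The affine involution replacing the first coordinate by one minus the sum of
all coordinates exchanges the slanted facet with a coordinate hyperplane. *)
Lemma mpoly_slant_dvd (R : realFieldType) n (p : {mpoly R[n.+1]}) :
  (forall x, \sum_i x i = 1 -> meval x p = 0) ->
  exists a, p = (1 - \sum_i 'X_i) * a.
Proof.
move=> H; pose L : {mpoly R[n.+1]} := 1 - \sum_i 'X_i.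
pose sw := [tuple if i == ord0 then L else 'X_i | i < n.+1].
have LE x : meval x L = 1 - \sum_i x i.
  rewrite /L mevalB meval1; congr (_ - _); rewrite raddf_sum /=.
  by apply: eq_bigr => i _; rewrite mevalXU.
have swE q x : meval x (comp_mpoly sw q) =
    meval (fun i => if i == ord0 then 1 - \sum_j x j else x i) q.
  rewrite comp_mpoly_meval; apply: meval_eq => i; rewrite tnth_mktuple.
  by case: eqP; rewrite ?LE ?mevalXU.
have [a pE] : exists a, comp_mpoly sw p = 'X_ord0 * a.
  apply: mpolyX_dvd => x x0 _; rewrite swE; apply: H.
  by rewrite big_ord_recl eqxx big_ord_recl x0 add0r subrK.
exists (comp_mpoly sw a).
have swK : comp_mpoly sw (comp_mpoly sw p) = p.
  apply/eqP; rewrite -subr_eq0; apply/eqP/(meval_box_eq0 ltr01) => x _.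
  rewrite mevalB !swE; apply/eqP; rewrite subr_eq0; apply/eqP/meval_eq => i.
  case: eqP => // ->; rewrite !big_ord_recl /=; ring.
by rewrite -{1}swK pE rmorphM /= comp_mpolyXU -tnth_nth tnth_mktuple eqxx.
Qed.

Section Moments.
Variables (R : realFieldType) (n : nat).
Implicit Types (p q : {mpoly R[n]}) (m : multinom n).

(** For N = n this is the integral of the monomial over the standard simplex of
dimension n, and for N = n - 1 its integral over the slanted facet, in the
coordinates given by projection along an axis. Keeping N free lets the
moments of both kinds be compared. *)
Definition mono_moment N m : R :=
  (\prod_(i < n) (m i)`!)%:R / (N + mdeg m)`!%:R.

Definition moment N p := \sum_(m <- msupp p) mcoeff m p * mono_moment N m.

Lemma moment_wE N p k : (msize p <= k)%N ->
  moment N p = \sum_(m : bmultinom n k) mcoeff m p * mono_moment N m.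
Proof.
move=> pk; rewrite /moment (big_mksub (bmultinom n k)) /=; first last.
- by move=> x /msize_mdeg_lt/leq_trans/(_ pk).
- by rewrite msupp_uniq.
by rewrite big_rmcond //= => j /memN_msupp_eq0 ->; rewrite mul0r.
Qed.

Lemma moment_is_linear N : linear_for *%R (moment N).
Proof.
move=> c p q; pose k := maxn (msize (c *: p + q)) (maxn (msize p) (msize q)).
rewrite !(@moment_wE _ _ k) ?leq_max ?leqnn ?orbT //.
rewrite mulr_sumr -big_split; apply: eq_bigr => m _ /=.
by rewrite mcoeffD mcoeffZ mulrDl -mulrA.
Qed.

HB.instance Definition _ N :=
  GRing.isLinear.Build R {mpoly R[n]} R *%R (moment N) (moment_is_linear N).

Lemma momentX N m : moment N (mpolyX R m) = mono_moment N m.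
Proof. by rewrite /moment msuppX big_seq1 mcoeffX eqxx mul1r. Qed.

Lemma mono_moment_mulX N m i :
  mono_moment N (mnm_add (mnm1 i) m) =
  (m i).+1%:R * (\prod_(j < n) (m j)`!)%:R / (N.+1 + mdeg m)`!%:R.
Proof.
rewrite /mono_moment mdegD mdeg1 addnA addn1 -natrM; congr (_%:R / _).
rewrite (bigD1 i) //= [in RHS](bigD1 i) //= mulnA; congr (_ * _)%N.
  by rewrite mnmDE mnm1E eqxx add1n factS.
by apply: eq_bigr => j ji; rewrite mnmDE mnm1E eq_sym (negbTE ji).
Qed.

(** Integration of a derivative along the i-th axis: X_i p vanishes at x_i = 0, so
only the slanted facet contributes. *)
Lemma moment_mderivXM N p i :
  moment N.+1 (mderiv i ('X_i * p)) = moment N ('X_i * p).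
Proof.
rewrite (mpolyE p) mulr_sumr (linear_sum (mderiv i)) !(linear_sum (moment _)).
apply: eq_bigr => m _ /=.
rewrite -scalerAr -mpolyXD mderivZ !linearZ /= momentX mono_moment_mulX.
rewrite mderivX linearZ /= momentX mnmDE mnm1E eqxx add1n.
by rewrite addmC addmK /mono_moment -!mulrA.
Qed.

(** The slanted facet is the zero set of 1 - sum_i x_i. *)
Lemma moment_slantM p : (0 < n)%N -> moment n.-1 ((1 - \sum_i 'X_i) * p) = 0.
Proof.
move=> n0; rewrite (mpolyE p) mulr_sumr raddf_sum big1 // => m _ /=.
rewrite -scalerAr linearZ /= mulrBl mul1r mulr_suml linearB linear_sum /=.
rewrite (eq_bigr (fun i : 'I_n => mono_moment n.-1 (mnm_add (mnm1 i) m))); last first.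
  by move=> i _; rewrite -mpolyXD momentX.
rewrite momentX (eq_bigr _ (fun i _ => mono_moment_mulX _ _ i)) -!mulr_suml.
rewrite -natr_sum prednK // {1}/mono_moment.
have -> : (n + mdeg m = (n.-1 + mdeg m).+1)%N by rewrite -addSn prednK.
rewrite factS natrM; set P := (\prod_(i < n) _)%:R.
have -> : (\sum_(i < n) (m i).+1 = (n.-1 + mdeg m).+1)%N.
  rewrite -addSn prednK // mdegE.
  rewrite (eq_bigr (fun i => 1 + m i)%N) => [|i _]; last by rewrite add1n.
  by rewrite big_split /= sum1_card card_ord.
set a := (_.+1)%:R; set b := (_`!)%:R.
have a0 : a != 0 :> R by rewrite pnatr_eq0.
have b0 : b != 0 :> R by rewrite pnatr_eq0 -lt0n fact_gt0.
apply/eqP; rewrite mulf_eq0 subr_eq0; apply/orP; right; apply/eqP.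
by rewrite invfM mulrACA divff // mul1r.
Qed.

End Moments.

(** The divergence theorem for a field without flux through any facet: v_i = 0 on
x_i = 0, and the sum of the v_i is the flux through the slanted facet. *)
Lemma moment_div_eq0 (R : realFieldType) n (v : 'I_n.+1 -> {mpoly R[n.+1]}) :
  (forall i x, x i = 0 -> meval x (v i) = 0) ->
  (forall x, \sum_i x i = 1 -> \sum_i meval x (v i) = 0) ->
  moment n.+1 (\sum_i mderiv i (v i)) = 0.
Proof.
move=> v0 vs.
have [b bE] : exists b, \sum_i v i = (1 - \sum_i 'X_i) * b.
  by apply: mpoly_slant_dvd => x /vs; rewrite raddf_sum.
rewrite -(moment_slantM b (ltn0Sn n)) -bE !linear_sum /=; apply: eq_bigr => i _.
have [a ->] : exists a, v i = 'X_i * a by apply: mpolyX_dvd => x /v0.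
exact: moment_mderivXM.
Qed.

(** * Iterated integrals of polynomials over the standard simplex *)

Import numFieldNormedType.Exports.

Section PolyPrimitive.
Variable R : realType.
Implicit Types (h : {poly R}) (t : R).

Definition antideriv h : {poly R} := \poly_(i < (size h).+1) (h`_i.-1 / i%:R).

Lemma coef_antideriv h i : (antideriv h)`_i = h`_i.-1 / i%:R.
Proof.
rewrite coef_poly; case: ltnP => // hi.
by rewrite nth_default ?mul0r //; case: i hi.
Qed.

Lemma deriv_antideriv h : (antideriv h)^`() = h.
Proof.
apply/polyP => i; rewrite coef_deriv coef_antideriv /=.
by rewrite -[LHS]mulr_natr divfK // pnatr_eq0.
Qed.

Lemma antideriv_horner0 h : (antideriv h).[0] = 0.
Proof. by rewrite horner_coef0 coef_antideriv invr0 mulr0. Qed.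

Lemma antideriv_is_linear : linear antideriv.
Proof.
move=> c p q; apply/polyP => i.
by rewrite coefD coefZ !coef_antideriv coefD coefZ mulrDl mulrA.
Qed.
HB.instance Definition _ :=
  GRing.isLinear.Build R {poly R} {poly R} _ antideriv antideriv_is_linear.

Lemma antideriv_deriv h t : (antideriv h^`()).[t] = h.[t] - h.[0].
Proof.
have -> : antideriv h^`() = h - (h.[0])%:P.
  apply/polyP => -[|i]; rewrite coefB coefC coef_antideriv.
    by rewrite horner_coef0 subrr invr0 mulr0.
  by rewrite subr0 coef_deriv /= -[X in X / _]mulr_natr mulfK // pnatr_eq0.
by rewrite hornerD hornerN hornerC.
Qed.

Lemma Rintegral_horner h t : 0 <= t ->
  \int[@lebesgue_measure R]_(x in `[0, t]%classic) h.[x] = (antideriv h).[t].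
Proof.
rewrite le_eqVlt => /predU1P[<-|t0].
  by rewrite set_itv1 Rintegral_set1 antideriv_horner0.
rewrite /Rintegral (@continuous_FTC2 _ _ (horner (antideriv h))) //.
- by rewrite antideriv_horner0 sube0.
- by apply/continuous_subspaceT => x; exact: continuous_horner.
- split=> [x _| |].
  + exact: derivable_horner.
  + by apply: cvg_at_right_filter; exact: continuous_horner.
  + by apply: cvg_at_left_filter; exact: continuous_horner.
- by move=> x _; rewrite -derivE deriv_antideriv.
Qed.

(** The antiderivative is nondecreasing; if it takes the same value at both ends
it is constant, and a polynomial that is constant on an interval has
derivative 0. *)
Lemma antideriv_ge0 h t : 0 < t -> (forall x, 0 < x < t -> 0 <= h.[x]) ->
  0 <= (antideriv h).[t] /\ ((antideriv h).[t] = 0 -> h = 0).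
Proof.
move=> t0 h0.
have mono : {in `[0, t]%R &, {homo horner (antideriv h) : x y / x <= y}}.
  apply: ger0_derive1_le_cc => [x _|x|].
  - exact: derivable_horner.
  - by rewrite in_itv /= -derivE deriv_antideriv => /h0.
  - by apply/continuous_subspaceT => x; exact: continuous_horner.
have t00 : 0 \in `[0, t]%R by rewrite in_itv /= lexx ltW.
have ttt : t \in `[0, t]%R by rewrite in_itv /= lexx ltW.
split; first by rewrite -(antideriv_horner0 h) mono // ltW.
move=> Ht; suff H0 : antideriv h = 0 by rewrite -(deriv_antideriv h) H0 deriv0.
apply: (poly_inf_roots t0) => x /andP[x0 xt].
have xx : x \in `[0, t]%R by rewrite in_itv /= !ltW.
apply/le_anti; rewrite -{1}Ht -(antideriv_horner0 h).
by rewrite !mono // ltW.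
Qed.

(** The Beta integral, by induction on a: the derivative of
x^(a+1) (t-x)^(N+1) has integral 0 over [0, t]. *)
Lemma antideriv_beta a N t :
  (antideriv ('X^a * (t%:P - 'X) ^+ N)).[t]
  = (a`! * N`!)%:R / (a + N).+1`!%:R * t ^+ (a + N).+1.
Proof.
have ex k : (t%:P - 'X : {poly R}).[t] ^+ k.+1 = 0.
  by rewrite !hornerE subrr expr0n.
have dr k : ((t%:P - 'X : {poly R}) ^+ k.+1)^`() = - (k.+1)%:R *: (t%:P - 'X) ^+ k.
  rewrite deriv_exp derivB derivC derivX sub0r mulN1r /= scaleNr.
  by rewrite mulNrn -scaler_nat.
have n0 k : k.+1%:R != 0 :> R by rewrite pnatr_eq0.
have f0 k : k`!%:R != 0 :> R by rewrite pnatr_eq0 -lt0n fact_gt0.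
elim: a N => [|a IH] N.
  have := antideriv_deriv ((t%:P - 'X) ^+ N.+1) t.
  rewrite dr linearZ /= hornerZ horner_exp ex sub0r ?expr0 !mul1r add0n.
  rewrite horner_exp !hornerE subr0 mulNr => /oppr_inj H.
  apply: (mulfI (n0 N)); rewrite H factS natrM.
  have := f0 N; have := n0 N; set u := _.+1%:R; set v := (_`!)%:R => A B.
  by rewrite !mulrA divff ?mul1r // mulf_neq0.
have := antideriv_deriv ('X^(a.+1) * (t%:P - 'X) ^+ N.+1) t.
have -> : ('X^(a.+1) * (t%:P - 'X) ^+ N.+1)^`() =
    a.+1%:R *: ('X^a * (t%:P - 'X) ^+ N.+1)
    - N.+1%:R *: ('X^(a.+1) * (t%:P - 'X) ^+ N).
  rewrite derivM dr derivXn /= mulrnAl -scaler_nat scaleNr mulrN.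
  by rewrite -scalerAr.
rewrite linearB hornerD hornerN !linearZ /= !hornerZ IH !hornerM.
rewrite !horner_exp ex mulr0 hornerX expr0n mul0r subrr.
move=> /eqP; rewrite subr_eq0 => /eqP H.
apply: (mulfI (n0 N)); rewrite -H addSnnS !factS !natrM.
have := f0 (a + N.+1)%N; have := n0 (a + N.+1)%N => A B.
move: ((a + N.+1).+1%:R) ((a + N.+1)`!%:R) (t ^+ _) A B => u v s A B.
by field; rewrite A B.
Qed.

End PolyPrimitive.

Section SimplexIntegral.
Variable R : realType.

(** Polynomial functions given by a list of terms. Fixing the first coordinate
keeps the list and only changes coefficients and exponents, so the induction
over the iterated integral needs no reordering of terms. *)
Definition monomial_sum (J : Type) (s : seq J) d (c : J -> R) (al : J -> 'I_d -> nat)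
    (y : 'cV[R]_d) : R :=
  \sum_(j <- s) c j * \prod_i y i 0 ^+ al j i.

Lemma monomial_sum_slice (J : Type) (s : seq J) d (c : J -> R)
    (al : J -> 'I_d.+1 -> nat) x (y : 'cV[R]_d) :
  monomial_sum s c al (col_mx (x%:M : 'cV_1) y) =
  monomial_sum s (fun j => c j * x ^+ al j ord0) (fun j i => al j (lift ord0 i)) y.
Proof.
apply: eq_bigr => j _; rewrite big_ord_recl -mulrA; congr (_ * (_ ^+ _ * _)).
  rewrite mxE; case: splitP => k //=; by rewrite ord1 mxE mulr1n.
apply: eq_bigr => i _; congr (_ ^+ _).
rewrite mxE; case: splitP => k /=; first by rewrite ord1.
by rewrite /bump /= add1n => -[] /val_inj ->.
Qed.

(** The inner integral of the iterated integral, as a polynomial in the outermost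
variable; see [std_simplex_integral_slice]. *)
Definition slice_poly (J : Type) (s : seq J) d (c : J -> R)
    (al : J -> 'I_d.+1 -> nat) (t : R) : {poly R} :=
  \sum_(j <- s) (c j * ((\prod_i (al j (lift ord0 i))`!)%:R
      / (d + \sum_i al j (lift ord0 i))`!%:R))
    *: ('X^(al j ord0) * (t%:P - 'X) ^+ (d + \sum_i al j (lift ord0 i))).

Lemma slice_horner (J : Type) (s : seq J) d (c : J -> R)
    (al : J -> 'I_d.+1 -> nat) (t x : R) : (slice_poly s c al t).[x] =
  \sum_(j <- s) (c j * x ^+ al j ord0)
    * ((\prod_i (al j (lift ord0 i))`!)%:R / (d + \sum_i al j (lift ord0 i))`!%:R)
    * (t - x) ^+ (d + \sum_i al j (lift ord0 i)).
Proof.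
rewrite horner_sum; apply: eq_bigr => j _.
rewrite hornerZ hornerM hornerXn horner_exp hornerD hornerN hornerC hornerX.
move: (_ / _) (_ ^+ (d + _)) (_ ^+ _) => u v w; ring.
Qed.

(** Dirichlet's formula. *)
Lemma std_simplex_integral_monomial_sum (J : Type) (s : seq J) d (c : J -> R)
    (al : J -> 'I_d -> nat) t : 0 <= t ->
  std_simplex_integral t (monomial_sum s c al) =
  \sum_(j <- s) c j * ((\prod_i (al j i)`!)%:R / (d + \sum_i al j i)`!%:R)
                 * t ^+ (d + \sum_i al j i).
Proof.
elim: d c al t => [|d IH] c al t t0.
  rewrite /= /monomial_sum; apply: eq_bigr => j _.
  by rewrite !big_ord0 addn0 fact0 divr1 expr0 !mulr1.
transitivity (\int[@lebesgue_measure R]_(x in `[0, t]%classic)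
    (slice_poly s c al t).[x]).
  apply: eq_Rintegral => x; rewrite inE /= in_itv /= => /andP[x0 xt].
  rewrite slice_horner -IH ?subr_ge0 //; congr std_simplex_integral.
  by apply/funext => y; rewrite monomial_sum_slice.
rewrite Rintegral_horner // linear_sum horner_sum; apply: eq_bigr => j _.
rewrite linearZ hornerZ /= antideriv_beta !big_ord_recl.
set N := (\sum_(i < d) _)%N; set P := (\prod_(i < d) _)%N; set a := al j ord0.
have f0 k : k`!%:R != 0 :> R by rewrite pnatr_eq0 -lt0n fact_gt0.
have -> : (d.+1 + (a + N) = (a + (d + N)).+1)%N by lia.
have A := f0 (d + N)%N; have B := f0 (a + (d + N)).+1.
move: ((a + (d + N)).+1`!%:R) (t ^+ _) B => v w B.
rewrite !natrM; move: ((d + N)`!%:R) A => u A.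
by field; rewrite A B.
Qed.

Lemma std_simplex_integral_slice (J : Type) (s : seq J) d (c : J -> R)
    (al : J -> 'I_d.+1 -> nat) t x : 0 <= x <= t ->
  std_simplex_integral (t - x) (fun y => monomial_sum s c al (col_mx (x%:M : 'cV_1) y))
  = (slice_poly s c al t).[x].
Proof.
move=> /andP[x0 xt].
rewrite slice_horner -std_simplex_integral_monomial_sum ?subr_ge0 //.
by congr std_simplex_integral; apply/funext => y; rewrite monomial_sum_slice.
Qed.

Definition open_simplex d (t : R) (y : 'cV[R]_d) :=
  (forall i, 0 < y i 0) /\ \sum_i y i 0 < t.

Lemma open_simplex_slice d (t x : R) (y : 'cV[R]_d) :
  0 < x -> open_simplex (t - x) y ->
  open_simplex (d := d.+1) t (col_mx (x%:M : 'cV_1) y).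
Proof.
move=> x0 [y0 yt]; split.
  move=> i; rewrite mxE; case: splitP => k _; last exact: y0.
  by rewrite ord1 mxE mulr1n.
rewrite big_ord_recl mxE; case: splitP => k //= _; rewrite ord1 mxE mulr1n.
rewrite -ltrBrDl; apply: le_lt_trans yt; rewrite le_eqVlt; apply/orP; left; apply/eqP.
apply: eq_bigr => i _; rewrite mxE; case: splitP => l /=; first by rewrite ord1.
by rewrite /bump /= add1n => -[] /val_inj ->.
Qed.

(** A polynomial that is nonnegative on the open simplex and has integral 0
vanishes there. The inner integral is a nonnegative polynomial in the
outer variable, so it vanishes identically, and the claim in lower dimension
applies to every slice. *)
Lemma std_simplex_integral_ge0 (J : Type) (s : seq J) d (c : J -> R)
    (al : J -> 'I_d -> nat) t : 0 < t ->
  (forall y, open_simplex t y -> 0 <= monomial_sum s c al y) ->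
  0 <= std_simplex_integral t (monomial_sum s c al) /\
  (std_simplex_integral t (monomial_sum s c al) = 0 ->
   forall y, open_simplex t y -> monomial_sum s c al y = 0).
Proof.
elim: d c al t => [|d IH] c al t t0 g0.
  have Y0 y : y = 0 :> 'cV[R]_0 by apply/colP; case.
  have os : open_simplex (d := 0) t 0 by split; [case | rewrite big_ord0].
  by split=> [|H y _]; [exact: g0 | rewrite (Y0 y)].
have IHs x : 0 < x < t ->
    0 <= (slice_poly s c al t).[x] /\
    ((slice_poly s c al t).[x] = 0 ->
     forall y, open_simplex (t - x) y ->
       monomial_sum s c al (col_mx (x%:M : 'cV_1) y) = 0).
  move=> /andP[x0 xt]; rewrite -std_simplex_integral_slice ?(ltW x0) ?(ltW xt) //.
  have -> : (fun y : 'cV_d => monomial_sum s c al (col_mx (x%:M : 'cV_1) y)) =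
      monomial_sum s (fun j => c j * x ^+ al j ord0) (fun j i => al j (lift ord0 i)).
    by apply/funext => y; rewrite monomial_sum_slice.
  have [|y ty|ge0 eq0] := IH (fun j => c j * x ^+ al j ord0)
    (fun j i => al j (lift ord0 i)) (t - x).
  - by rewrite subr_gt0.
  - by rewrite -monomial_sum_slice; apply/g0/open_simplex_slice.
  by split=> // /eq0 H y /H; rewrite monomial_sum_slice.
have -> : std_simplex_integral t (monomial_sum s c al) =
    (antideriv (slice_poly s c al t)).[t].
  rewrite -Rintegral_horner ?(ltW t0) //; apply: eq_Rintegral => x.
  by rewrite inE /= in_itv /= => xt; exact: std_simplex_integral_slice.
have [ge0 eq0] := antideriv_ge0 t0 (fun x xt => (IHs x xt).1).
split=> // /eq0 sp0 y [y0 yt].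
have yE : y = col_mx ((y ord0 0)%:M : 'cV_1) (\col_i y (lift ord0 i) 0).
  apply/colP => i; rewrite mxE; case: splitP => k /= ik.
    by rewrite mxE ord1 mulr1n; congr (y _ 0); apply/val_inj; rewrite /= ik ord1.
  by rewrite mxE; congr (y _ 0); apply/val_inj; rewrite /= ik.
move: yt; rewrite big_ord_recl => yt.
have s0 : 0 <= \sum_(i < d) y (lift ord0 i) 0 by apply: sumr_ge0 => i _; apply/ltW/y0.
rewrite yE; apply: (IHs _ _).2.
- by rewrite y0 (le_lt_trans _ yt) // lerDl.
- by rewrite sp0 horner0.
split=> [i|]; first by rewrite mxE.
rewrite ltrBrDl; under eq_bigr => i _ do rewrite mxE.
exact: yt.
Qed.

End SimplexIntegral.

(** * Weighted squares and tangential vector fields on a simplex *)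

Section SimplexMoments.
Variables (R : realType) (n : nat).
Implicit Types (p : {mpoly R[n]}).

Lemma std_simplex_integral_moment p :
  std_simplex_integral 1 (fun y : 'cV[R]_n => meval (fun l => y l 0) p)
  = moment n p.
Proof.
have -> : (fun y : 'cV[R]_n => meval (fun l => y l 0) p)
    = monomial_sum (msupp p) (fun m => mcoeff m p) (fun m i => m i).
  by apply/funext => y; rewrite mevalE.
rewrite std_simplex_integral_monomial_sum ?ler01 //; apply: eq_bigr => m _.
by rewrite expr1n mulr1 /mono_moment mdegE.
Qed.

Lemma moment_ge0_eq0 p :
  (forall x, (forall i, 0 < x i) -> \sum_i x i < 1 -> 0 <= meval x p) ->
  moment n p = 0 -> p = 0.
Proof.
move=> p0; rewrite -std_simplex_integral_moment.
have pE (y : 'cV[R]_n) : meval (fun l => y l 0) p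
    = monomial_sum (msupp p) (fun m => mcoeff m p) (fun m i => m i) y by rewrite mevalE.
have -> : (fun y : 'cV[R]_n => meval (fun l => y l 0) p)
    = monomial_sum (msupp p) (fun m => mcoeff m p) (fun m i => m i) by apply/funext.
have [|_ H /H {}H] := std_simplex_integral_ge0 (s := msupp p) (d := n)
    (c := fun m => mcoeff m p) (al := fun m i => m i) ltr01.
  by move=> y [y0 y1]; rewrite -pE; apply: p0.
have n0 : 0 < n.+1%:R :> R by rewrite ltr0n.
apply: (@meval_box_eq0 _ _ _ (n.+1%:R)^-1) => [|x x0]; first by rewrite invr_gt0.
have := H (\col_i x i); rewrite -pE => <-.
  by apply: meval_eq => i; rewrite mxE.
split=> [i|]; first by rewrite mxE; case/andP: (x0 i).
apply: (@le_lt_trans _ _ (\sum_(i < n) n.+1%:R^-1)).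
  by apply: ler_sum => i _; rewrite mxE; case/andP: (x0 i) => _ /ltW.
by rewrite sumr_const card_ord -[X in X < _]mulr_natl ltr_pdivrMr // mul1r ltr_nat.
Qed.

(** The source of every vanishing result below: a field is tested with its own
quotient by the weights. *)
Lemma moment_squares_eq0 (I : finType) (lam a : I -> {mpoly R[n]}) :
  (forall i x, (forall j, 0 < x j) -> 0 < meval x (lam i)) ->
  moment n (\sum_i lam i * a i ^+ 2) = 0 -> forall i, a i = 0.
Proof.
move=> lam0 H i.
have ge0 j x : (forall l, 0 < x l) -> 0 <= meval x (lam j * a j ^+ 2).
  by move=> x0; rewrite rmorphM rmorphXn /= mulr_ge0 ?sqr_ge0 // ltW // lam0.
have {}H : \sum_i lam i * a i ^+ 2 = 0.
  apply: moment_ge0_eq0 H => x x0 _.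
  by rewrite raddf_sum; apply: sumr_ge0 => j _; apply: ge0.
apply: (meval_box_eq0 ltr01) => x x01.
have x0 j : 0 < x j by case/andP: (x01 j).
have /eqP := congr1 (meval x) H; rewrite raddf0 raddf_sum psumr_eq0 /=; last first.
  by move=> j _; apply: ge0.
move=> /allP/(_ i (mem_index_enum _)); rewrite rmorphM rmorphXn /= mulf_eq0.
by rewrite gt_eqF ?lam0 //= sqrf_eq0 => /eqP.
Qed.

End SimplexMoments.

Lemma mderivXU (R : realFieldType) n (i j : 'I_n) :
  mderiv i ('X_j : {mpoly R[n]}) = (i == j)%:R.
Proof.
apply/mpolyP => m; rewrite mcoeff_deriv mcoeffX.
have [<-|ij] := eqVneq i j.
  rewrite mcoeff1.
  have -> : (mnm1 i == mnm_add m (mnm1 i)) = (m == mnm0).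
    by rewrite -{1}[mnm1 i]add0m eqm_add2r eq_sym.
  by case: eqP => [->|_]; rewrite ?mnm0E ?mul0rn.
rewrite mcoeff0; case: eqP => [mE|_]; last by rewrite mul0rn.
have := congr1 (fun m' : multinom n => m' i) mE.
by rewrite /= mnm1E mnmDE mnm1E eqxx addn1 eq_sym (negbTE ij).
Qed.

(** Integration by parts without boundary term: the divergence theorem for q v. *)
Lemma moment_by_parts (R : realFieldType) n (v : 'I_n.+1 -> {mpoly R[n.+1]}) q :
  (forall i x, x i = 0 -> meval x (v i) = 0) ->
  (forall x, \sum_i x i = 1 -> \sum_i meval x (v i) = 0) ->
  moment n.+1 (q * \sum_i mderiv i (v i)) = - moment n.+1 (\sum_i v i * mderiv i q).
Proof.
move=> v0 vs; apply/eqP; rewrite -subr_eq0 opprK -linearD /=.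
rewrite mulr_sumr -big_split /=.
rewrite (eq_bigr (fun i => mderiv i (q * v i))); last first.
  by move=> i _; rewrite mderivM addrC [v i * _]mulrC.
rewrite moment_div_eq0 // => [i x xi|x x1].
  by rewrite mevalM v0 ?mulr0.
under eq_bigr => i _ do rewrite mevalM.
by rewrite -mulr_sumr vs // mulr0.
Qed.

(** Unisolvence of the interior moments for divergence-conforming fields of
Raviart-Thomas type: the second hypothesis says that the contraction of the
associated form with the position vector has degree at most k. *)
Lemma flux_field_eq0 (R : realType) n k (g : 'I_n.+2 -> {mpoly R[n.+2]}) :
  (forall i, msize (g i) <= k.+1)%N ->
  (forall i j, msize ('X_j * g i - 'X_i * g j) <= k.+1)%N ->
  (forall i x, x i = 0 -> meval x (g i) = 0) ->
  (forall x, \sum_i x i = 1 -> \sum_i meval x (g i) = 0) ->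
  (forall q : 'I_n.+2 -> {mpoly R[n.+2]}, (forall i, msize (q i) <= k.-1)%N ->
     moment n.+2 (\sum_i g i * q i) = 0) ->
  forall i, g i = 0.
Proof.
move=> gk gtrim g0 g1 gorth.
have kk : (k <= k.-1.+1)%N by case: (k).
pose dv := \sum_i mderiv i (g i).
have dvk : (msize dv <= k)%N by apply: msize_sum_leq => i _; apply: msize_mderiv.
(* moments against the gradient of div g *)
have dv0 : dv = 0.
  have := @moment_squares_eq0 R n.+2 unit (fun=> 1) (fun=> dv).
  apply; [by move=> _ x _; rewrite meval1 | | exact: tt].
  rewrite big_const card_unit /= addr0 mul1r expr2.
  rewrite moment_by_parts // gorth ?oppr0 // => i.
  exact: msize_mderiv (leq_trans dvk kk).
(* As div g = 0, the divergence in j of X_j g_i - X_i g_j is (E + n + 1) g_i. *)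
have {}gk i : (msize (g i) <= k)%N.
  apply: (@msize_Euler _ _ _ n.+1) => //.
  have -> : \sum_j 'X_j * mderiv j (g i) + n.+1%:R *: g i =
      \sum_j mderiv j ('X_j * g i - 'X_i * g j).
    rewrite [RHS](eq_bigr (fun j => 'X_j * mderiv j (g i) + g i -
        ((i == j)%:R * g j + 'X_i * mderiv j (g j)))); last first.
      move=> j _; rewrite mderivB !mderivM !mderivXU eqxx mul1r.
      by rewrite [j == i]eq_sym [g i + _]addrC.
    rewrite sumrB !big_split /= -mulr_sumr -/dv dv0 mulr0 addr0 sumr_const card_ord.
    have -> : \sum_j (i == j)%:R * g j = g i.
      rewrite (bigD1 i) //= eqxx mul1r big1 ?addr0 // => j ji.
      by rewrite eq_sym (negbTE ji) mul0r.
    rewrite -addrA -[g i *+ n.+2]/(g i + g i *+ n.+1).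
    by rewrite [g i + _]addrC addrK scaler_nat.
  apply: msize_sum_leq => j _; apply: msize_mderiv; exact: gtrim.
have /fin_all_exists[a ga] : forall i, exists a, g i = 'X_i * a.
  by move=> i; apply: mpolyX_dvd => x xi _; apply: g0.
have ak i : (msize (a i) <= k.-1)%N.
  by apply: (@msizeMX_ge _ _ _ i); rewrite -ga; apply: leq_trans (gk i) kk.
suff a0 i : a i = 0 by move=> i; rewrite ga a0 mulr0.
apply: (@moment_squares_eq0 R n.+2 _ (fun i => 'X_i) a).
  by move=> j x x0; rewrite mevalXU.
rewrite -[RHS](gorth a ak); congr (moment _ _); apply: eq_bigr => j _.
by rewrite ga -mulrA.
Qed.

(** * Polynomial 2-forms in four variables *)

(** Cartan's formula for the Lie derivative along the position vector: for a closed
F it equals the exterior derivative of the contraction, and it acts on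
coefficients as E + 2. So F has the degree of a derivative of F(x) x. *)
Lemma closed_trimmed_degree (R : realFieldType) n k (F : 'I_n -> 'I_n -> {mpoly R[n]}) :
  (forall i j, F i j = - F j i) ->
  (forall i j l, mderiv i (F j l) + mderiv j (F l i) + mderiv l (F i j) = 0) ->
  (forall i, msize (\sum_j F i j * 'X_j) <= k.+1)%N ->
  forall i j, (msize (F i j) <= k)%N.
Proof.
move=> Fskew Fclosed Ftrim i l.
apply: (@msize_Euler _ _ _ 2) => //.
have dr a b : mderiv b (\sum_j F a j * 'X_j) =
    \sum_j 'X_j * mderiv b (F a j) + F a b.
  rewrite linear_sum /=.
  rewrite (eq_bigr (fun j => 'X_j * mderiv b (F a j) + F a j * (b == j)%:R)); last first.
    by move=> j _; rewrite mderivM mderivXU mulrC.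
  rewrite big_split /=; congr (_ + _).
  by rewrite (bigD1 b) //= eqxx mulr1 big1 ?addr0 // => j ji;
    rewrite eq_sym (negbTE ji) mulr0.
have -> : \sum_j 'X_j * mderiv j (F i l) + 2%:R *: F i l =
    mderiv l (\sum_j F i j * 'X_j) - mderiv i (\sum_j F l j * 'X_j).
  rewrite !dr (Fskew l i) scaler_nat mulr2n opprD opprK addrACA -sumrB.
  congr (_ + _); apply: eq_bigr => j _; rewrite -mulrBr; congr (_ * _).
  have := Fclosed j i l; rewrite (Fskew l j) mderivN => /eqP.
  rewrite -subr_eq0 => /eqP H; apply/eqP; rewrite -subr_eq0 -H.
  by apply/eqP; rewrite (Fskew i j) mderivN; ring.
by apply: msizeB_leq; apply: msize_mderiv.
Qed.

Local Notation i0 := (@Ordinal 4 0 isT).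
Local Notation i1 := (@Ordinal 4 1 isT).
Local Notation i2 := (@Ordinal 4 2 isT).
Local Notation i3 := (@Ordinal 4 3 isT).

Lemma ord4_ind (P : 'I_4 -> Prop) : P i0 -> P i1 -> P i2 -> P i3 -> forall i, P i.
Proof.
move=> P0 P1 P2 P3 [[|[|[|[|m]]]] mP] //.
- by rewrite (_ : Ordinal mP = i0) //; apply/val_inj.
- by rewrite (_ : Ordinal mP = i1) //; apply/val_inj.
- by rewrite (_ : Ordinal mP = i2) //; apply/val_inj.
- by rewrite (_ : Ordinal mP = i3) //; apply/val_inj.
Qed.

Lemma sum_ord4 (V : nmodType) (f : 'I_4 -> V) :
  \sum_i f i = f i0 + f i1 + f i2 + f i3.
Proof.
rewrite !big_ord_recl big_ord0 addr0 !addrA.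
by congr (f _ + f _ + f _ + f _); apply/val_inj.
Qed.

(** The Hodge star on 2-forms in dimension four. *)
Definition star (A : zmodType) (F : 'I_4 -> 'I_4 -> A) (i j : 'I_4) : A :=
  nth 0 (nth [::]
    [:: [:: 0; F i2 i3; - F i1 i3; F i1 i2];
        [:: - F i2 i3; 0; F i0 i3; - F i0 i2];
        [:: F i1 i3; - F i0 i3; 0; F i0 i1];
        [:: - F i1 i2; F i0 i2; - F i0 i1; 0]] i) j.

Lemma star_skew (A : zmodType) (F : 'I_4 -> 'I_4 -> A) i j :
  star F i j = - star F j i.
Proof.
by elim/ord4_ind: i; elim/ord4_ind: j; rewrite /star /= ?opprK ?oppr0.
Qed.

(** The Hodge star is self-adjoint, so testing F against all skew matrices amounts
to testing its dual against all matrices. *)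
Lemma star_pairing (A : comNzRingType) (F P : 'I_4 -> 'I_4 -> A) :
  (forall i j, F i j = - F j i) -> (forall i, F i i = 0) ->
  \sum_i \sum_j F i j * star (fun i j => P i j - P j i) i j
  = (\sum_i \sum_j star F i j * P i j) *+ 2.
Proof.
move=> Fs F0; rewrite !sum_ord4 /star /= !F0.
rewrite (Fs i1 i0) (Fs i2 i0) (Fs i3 i0) (Fs i2 i1) (Fs i3 i1) (Fs i3 i2).
ring.
Qed.

(** The row divergences of the dual of F are, up to sign, the four coefficients of
the exterior derivative of F. *)
Lemma star_div_closed (R : realFieldType) (F : 'I_4 -> 'I_4 -> {mpoly R[4]}) :
  (forall i j, F i j = - F j i) -> (forall i, F i i = 0) ->
  (forall l, \sum_i mderiv i (star F l i) = 0) ->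
  forall i j l, mderiv i (F j l) + mderiv j (F l i) + mderiv l (F i j) = 0.
Proof.
move=> Fs Fd divH i j l.
have c0 := divH i0; have c1 := divH i1; have c2 := divH i2; have c3 := divH i3.
rewrite !sum_ord4 /star /= !(mderivN, mderiv0) in c0 c1 c2 c3.
elim/ord4_ind: i; elim/ord4_ind: j; elim/ord4_ind: l;
rewrite ?Fd ?(Fs i1 i0) ?(Fs i2 i0) ?(Fs i3 i0) ?(Fs i2 i1) ?(Fs i3 i1) ?(Fs i3 i2)
  ?(mderivN, mderiv0); try ring.
all: solve [apply: (etrans _ c0); ring | apply: (etrans _ c1); ring
  | apply: (etrans _ c2); ring | apply: (etrans _ c3); ring
  | apply/oppr_inj; rewrite oppr0; apply: (etrans _ c0); ring
  | apply/oppr_inj; rewrite oppr0; apply: (etrans _ c1); ring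
  | apply/oppr_inj; rewrite oppr0; apply: (etrans _ c2); ring
  | apply/oppr_inj; rewrite oppr0; apply: (etrans _ c3); ring].
Qed.

(** The unisolvence of the interior moments among 2-forms whose trace vanishes on
all five facets. The trace hypotheses say that each row of the Hodge dual H is
a vector field tangential at the boundary. *)
Lemma bubble_form_eq0 (R : realType) k (F : 'I_4 -> 'I_4 -> {mpoly R[4]}) :
  (forall i j, F i j = - F j i) ->
  (forall i j, msize (F i j) <= k.+1)%N ->
  (forall i, msize (\sum_j F i j * 'X_j) <= k.+1)%N ->
  (forall l i j x, i != l -> j != l -> x l = 0 -> meval x (F i j) = 0) ->
  (forall i j l x, \sum_m x m = 1 -> meval x (F i j + F j l + F l i) = 0) ->
  (forall Q : 'I_4 -> 'I_4 -> {mpoly R[4]},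
     (forall i j, Q i j = - Q j i) -> (forall i j, msize (Q i j) <= k.-2)%N ->
     moment 4 (\sum_i \sum_j F i j * Q i j) = 0) ->
  forall i j, F i j = 0.
Proof.
move=> Fs Fk Ftrim F0 F1 Forth.
have Fd i : F i i = 0.
  have /eqP := Fs i i; rewrite -subr_eq0 opprK -mulr2n -scaler_nat.
  by rewrite scaler_eq0 pnatr_eq0 /= => /eqP.
pose H := star F.
have Hd l : H l l = 0 by rewrite /H; elim/ord4_ind: l.
have Horth (P : 'I_4 -> 'I_4 -> {mpoly R[4]}) :
    (forall i j, msize (P i j) <= k.-2)%N ->
    moment 4 (\sum_i \sum_j H i j * P i j) = 0.
  move=> Pk; have := Forth (star (fun i j => P i j - P j i)) (star_skew _).
  rewrite star_pairing // raddfMn => /(_ _)/eqP.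
  rewrite -mulr_natr mulf_eq0 pnatr_eq0 orbF => X; apply/eqP/X.
  have PB i j : (msize (P i j - P j i) <= k.-2)%N by apply: msizeB_leq.
  by move=> i j; elim/ord4_ind: i; elim/ord4_ind: j; rewrite /star /= ?msizeN ?msize0.
have H0r l i x : x i = 0 -> meval x (H l i) = 0.
  by move=> xi; rewrite /H; elim/ord4_ind: l; elim/ord4_ind: i xi => xi;
    rewrite /star /= ?raddfN /= ?raddf0 // (F0 _ _ _ x _ _ xi) ?oppr0.
have H0l l i x : x l = 0 -> meval x (H l i) = 0.
  by move=> xl; rewrite /H star_skew raddfN /= -/H H0r ?oppr0.
have H1 l x : \sum_i x i = 1 -> \sum_i meval x (H l i) = 0.
  move=> x1; rewrite sum_ord4 /H.
  have F1' i j m : meval x (F i j) + meval x (F j m) = meval x (F i m).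
    by have /eqP := F1 i j m x x1; rewrite !mevalD (Fs m i) mevalN subr_eq0 => /eqP.
  elim/ord4_ind: l; rewrite /star /= ?raddfN /= ?raddf0.
  - rewrite -(F1' i1 i2 i3); ring.
  - rewrite -(F1' i0 i2 i3); ring.
  - rewrite -(F1' i0 i1 i3); ring.
  - rewrite -(F1' i0 i1 i2); ring.
(* H_li vanishes also on x_l = 0, so x_l divides the divergence of row l *)
have /fin_all_exists[b Hb] l : exists b, forall i, H l i = 'X_l * b i.
  apply: (fin_all_exists (P := fun i b => H l i = 'X_l * b)) => i.
  by apply: mpolyX_dvd => x xl _; apply: H0l.
pose e l := \sum_(i | i != l) mderiv i (b l i).
have divH l : \sum_i mderiv i (H l i) = 'X_l * e l.
  rewrite (bigD1 l) //= Hd mderiv0 add0r mulr_sumr; apply: eq_bigr => i il.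
  by rewrite Hb mderivM mderivXU (negbTE il) mul0r add0r.
have Hk l i : (msize (H l i) <= k.+1)%N.
  by rewrite /H; elim/ord4_ind: l; elim/ord4_ind: i; rewrite /star /= ?msizeN ?msize0.
have kk : (k <= k.-1.+1)%N by case: (k).
have ek l : (msize (e l) <= k.-1)%N.
  apply: (@msizeMX_ge _ _ _ l); rewrite -divH.
  by apply: msize_sum_leq => i _; apply: msize_mderiv; apply: leq_trans (Hk l i) _.
have kkk : (k.-1 <= k.-2.+1)%N by case: (k) => [|[]].
(* integration by parts turns the integral of the sum of x_l e_l^2 into a
   moment of F against the differential of the 1-form e *)
have e0 l : e l = 0.
  apply: (@moment_squares_eq0 R 4 _ (fun i => 'X_i) e) l.
    by move=> j x x0; rewrite mevalXU.
  rewrite linear_sum /=.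
  rewrite (eq_bigr (fun l => - moment 4 (\sum_i H l i * mderiv i (e l)))).
    rewrite sumrN -linear_sum /= Horth ?oppr0 // => i j.
    exact: msize_mderiv (leq_trans (ek i) kkk).
  move=> l _; rewrite expr2 mulrCA -divH moment_by_parts //.
    exact: H0r.
  exact: H1.
have {}divH l : \sum_i mderiv i (H l i) = 0 by rewrite divH e0 mulr0.
have Fclosed := star_div_closed Fs Fd divH.
have {}Fk := closed_trimmed_degree Fs Fclosed Ftrim.
have {}Hk l i : (msize (H l i) <= k)%N.
  by rewrite /H; elim/ord4_ind: l; elim/ord4_ind: i; rewrite /star /= ?msizeN ?msize0.
have exa (p : 'I_4 * 'I_4) : exists a, H p.1 p.2 = 'X_p.1 * 'X_p.2 * a.
  case: p => l i /=; have [<-|il] := eqVneq i l.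
    by exists 0; rewrite Hd mulr0.
  have [a ba] : exists a, b l i = 'X_i * a.
    apply: mpolyX_dvd => x xi x0.
    have /eqP := H0r l i x xi; rewrite Hb mevalM mevalXU mulf_eq0.
    have /andP[xl _] : 0 < x l < 1 by apply: x0; rewrite eq_sym.
    by rewrite gt_eqF //= => /eqP.
  by exists a; rewrite Hb ba mulrA.
have /fin_all_exists[a Ha] := exa.
have ak p : (msize (a p) <= k.-2)%N.
  apply: (@msizeMX_ge _ _ _ p.2); apply: (@msizeMX_ge _ _ _ p.1).
  rewrite mulrA -Ha; apply: leq_trans (Hk _ _) _; exact: leq_trans kk _.
have a0 : forall p, a p = 0.
  apply: (@moment_squares_eq0 R 4 _ (fun p => 'X_p.1 * 'X_p.2) a).
    by move=> j x x0; rewrite mevalM !mevalXU mulr_gt0.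
  rewrite -[RHS](Horth (fun l i => a (l, i))) => [|i j]; last exact: ak.
  rewrite pair_big /=; congr (moment _ _); apply: eq_bigr => -[l i] _ /=.
  by have /= -> := Ha (l, i); rewrite expr2 !mulrA.
have H00 l i : H l i = 0 by rewrite (Ha (l, i)) a0 mulr0.
have FH : [/\ F i0 i1 = H i2 i3, F i0 i2 = - H i1 i3, F i0 i3 = H i1 i2,
    F i1 i2 = H i0 i3 & F i1 i3 = - H i0 i2 /\ F i2 i3 = H i0 i1].
  by rewrite /H /star /= !opprK.
move: FH; rewrite !H00 oppr0 => -[f01 f02 f03 f12 [f13 f23]] i j.
elim/ord4_ind: i; elim/ord4_ind: j;
  rewrite ?Fd // Fs ?(f01, f02, f03, f12, f13, f23) ?oppr0 //.
all: by rewrite Fs ?(f01, f02, f03, f12, f13, f23) ?oppr0.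
Qed.

(** * The Levi-Civita product in an adapted frame *)

Section CrossForm.
Variable R : realType.
Implicit Types (a b c d : 'cV[R]_4) (A M : 'M[R]_4).

(** Up to the factor 2, the wedge product of the covectors a and b and the 2-form A;
the degrees of freedom on facets and triangles are integrals of this form. *)
Definition cross_form a b A := dot (cross b A) a.

Lemma cross_formE a b A : cross_form a b A =
  \sum_(s : 'S_4) (-1) ^+ s * a (s i0) 0 * b (s i1) 0 * A (s i2) (s i3).
Proof.
pose t (s : 'S_4) (i j k l : 'I_4) :=
  ((s i0 == i) && (s i1 == j) && (s i2 == k) && (s i3 == l))%:R : R.
have lcE i j k l : levi_civita R i j k l = \sum_(s : 'S_4) t s i j k l * (-1) ^+ s.
  rewrite /levi_civita big_mkcond; apply: eq_bigr => s _.
  have -> : [forall a, s a == tnth [tuple i; j; k; l] a] =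
      (s i0 == i) && (s i1 == j) && (s i2 == k) && (s i3 == l).
    apply/forallP/idP => [H|/andP[/andP[/andP[H0 H1] H2] H3]].
      have := (H i0, H i1, H i2, H i3); rewrite !(tnth_nth i) /=.
      by do 4! case=> [[]]; move=> -> -> -> ->.
    by elim/ord4_ind; rewrite (tnth_nth i).
  by rewrite /t; case: ifP => _; rewrite ?mul1r ?mul0r.
transitivity (\sum_(s : 'S_4) \sum_i \sum_j \sum_k \sum_l
    t s i j k l * ((-1) ^+ s * a i 0 * b j 0 * A k l)).
  rewrite [RHS]exchange_big; apply: eq_bigr => i _; rewrite mxE mulr_suml.
  rewrite [RHS]exchange_big; apply: eq_bigr => j _; rewrite mulr_suml.
  rewrite [RHS]exchange_big; apply: eq_bigr => k _; rewrite mulr_suml.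
  rewrite [RHS]exchange_big; apply: eq_bigr => l _; rewrite lcE !mulr_suml.
  apply: eq_bigr => s _ /=; rewrite -!mulrA; congr (_ * (_ * _)).
  by rewrite mulrA mulrC.
apply: eq_bigr => s _.
have pick1 (f : 'I_4 -> R) i : (forall j, j != i -> f j = 0) -> \sum_j f j = f i.
  by move=> f0; rewrite (bigD1 i) //= big1 ?addr0.
rewrite (pick1 _ (s i0)) => [|i]; last first.
  rewrite eq_sym /t => /negbTE ->; do 3! (rewrite big1 // => ? _).
  by rewrite mul0r.
rewrite (pick1 _ (s i1)) => [|i]; last first.
  rewrite eq_sym /t => /negbTE ->; do 2! (rewrite big1 // => ? _).
  by rewrite andbF mul0r.
rewrite (pick1 _ (s i2)) => [|i]; last first.
  rewrite eq_sym /t => /negbTE ->; rewrite big1 // => ? _.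
  by rewrite andbF mul0r.
rewrite (pick1 _ (s i3)) => [|i]; last first.
  by rewrite eq_sym /t => /negbTE ->; rewrite andbF mul0r.
by rewrite /t !eqxx mul1r.
Qed.

Lemma cross_form_is_linear a b : linear_for *%R (cross_form a b).
Proof.
move=> x A B; rewrite !cross_formE mulr_sumr -big_split; apply: eq_bigr => s _ /=.
by rewrite !mxE mulrDr mulrCA.
Qed.
HB.instance Definition _ a b :=
  GRing.isLinear.Build R 'M[R]_4 R *%R (cross_form a b) (cross_form_is_linear a b).

Definition frame_mx a b c d : 'M[R]_4 := \matrix_(i, j) (nth a [:: a; b; c; d] i) j 0.

Lemma cross_form_outer a b c d : cross_form a b (c *m d^T) = \det (frame_mx a b c d).
Proof.
rewrite cross_formE /determinant; apply: eq_bigr => s _.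
rewrite !big_ord_recl big_ord0 mulr1 -!mulrA !mxE big_ord1 !mxE /=.
by congr (_ * (a _ 0 * (b _ 0 * (c _ 0 * d _ 0)))); apply: (congr1 s); apply/val_inj.
Qed.

Lemma cross_form_delta a b A :
  cross_form a b A =
  \sum_i \sum_j A i j * \det (frame_mx a b (delta_mx i 0) (delta_mx j 0)).
Proof.
rewrite [in LHS](matrix_sum_delta A) linear_sum; apply: eq_bigr => i _.
rewrite linear_sum; apply: eq_bigr => j _.
by rewrite linearZ -cross_form_outer trmx_delta mul_delta_mx.
Qed.

(** Both sides are linear in A, which reduces the law to products c d^T; there it
is the multiplicativity of the determinant. *)
Lemma cross_form_mulmx M a b A :
  cross_form (M^T *m a) (M^T *m b) (M^T *m A *m M) = \det M * cross_form a b A.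
Proof.
rewrite [in RHS]cross_form_delta [in LHS](matrix_sum_delta A).
rewrite mulmx_sumr mulmx_suml linear_sum mulr_sumr; apply: eq_bigr => i _.
rewrite mulmx_sumr mulmx_suml linear_sum mulr_sumr; apply: eq_bigr => j _.
rewrite -scalemxAr -scalemxAl linearZ /= mulrCA; congr (_ * _).
rewrite -(mul_delta_mx (0 : 'I_1)) -[delta_mx 0 j]trmx_delta.
have -> : M^T *m (delta_mx i 0 *m (delta_mx j (0 : 'I_1))^T) *m M
    = (M^T *m delta_mx i 0) *m (M^T *m delta_mx j (0 : 'I_1))^T.
  by rewrite trmx_mul trmxK !mulmxA.
rewrite cross_form_outer mulrC -det_mulmx; congr (\det _); apply/matrixP => p q.
rewrite !mxE; elim/ord4_ind: p; rewrite /= !mxE; apply: eq_bigr => l _.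
all: by rewrite !mxE mulrC.
Qed.

Lemma det3 (f : nat -> nat -> R) :
  \det (\matrix_(i < 3, j < 3) f i j) =
  f 0 0 * (f 1 1 * f 2 2 - f 1 2 * f 2 1)
  - f 0 1 * (f 1 0 * f 2 2 - f 1 2 * f 2 0)
  + f 0 2 * (f 1 0 * f 2 1 - f 1 1 * f 2 0).
Proof.
rewrite (expand_det_row _ ord0) !big_ord_recl big_ord0 /cofactor.
rewrite !(expand_det_row _ ord0) !big_ord_recl !big_ord0 /cofactor !det_mx11.
rewrite !mxE /= /bump /=; ring.
Qed.

Lemma det4 (f : nat -> nat -> R) :
  let minor j := \det (\matrix_(p < 3, q < 3) f p.+1 (bump j q)) in
  \det (\matrix_(i < 4, j < 4) f i j) =
  f 0 0 * minor 0 - f 0 1 * minor 1 + f 0 2 * minor 2 - f 0 3 * minor 3.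
Proof.
rewrite /= (expand_det_row _ ord0) !big_ord_recl big_ord0 /cofactor !mxE /=.
have E j : \det (row' ord0 (col' j (\matrix_(i < 4, j < 4) f i j))) =
    \det (\matrix_(p < 3, q < 3) f p.+1 (bump j q)).
  by congr (\det _); apply/matrixP => p q; rewrite !mxE.
rewrite !E /= /bump /=; ring.
Qed.

Lemma cross_form_outer_explicit a b c d (A := c *m d^T) : cross_form a b A =
  (a i0 0 * b i1 0 - a i1 0 * b i0 0) * (A i2 i3 - A i3 i2)
  - (a i0 0 * b i2 0 - a i2 0 * b i0 0) * (A i1 i3 - A i3 i1)
  + (a i0 0 * b i3 0 - a i3 0 * b i0 0) * (A i1 i2 - A i2 i1)
  + (a i1 0 * b i2 0 - a i2 0 * b i1 0) * (A i0 i3 - A i3 i0)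
  - (a i1 0 * b i3 0 - a i3 0 * b i1 0) * (A i0 i2 - A i2 i0)
  + (a i2 0 * b i3 0 - a i3 0 * b i2 0) * (A i0 i1 - A i1 i0).
Proof.
rewrite /A cross_form_outer.
pose f i j := (nth a [:: a; b; c; d] i) (inord j) 0.
have -> : frame_mx a b c d = \matrix_(i < 4, j < 4) f i j.
  by apply/matrixP => i j; rewrite !mxE /f inord_val.
have E (i : 'I_4) j : i = j :> nat -> inord j = i.
  by move=> <-; rewrite inord_val.
rewrite det4 (det3 (fun p q => f p.+1 (bump 0 q))) (det3 (fun p q => f p.+1 (bump 1 q))).
rewrite (det3 (fun p q => f p.+1 (bump 2 q))) (det3 (fun p q => f p.+1 (bump 3 q))).
rewrite /bump /= /f /=.
rewrite (E i0 0) // (E i1 1) // (E i2 2) // (E i3 3) //.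
rewrite !mxE !big_ord1 !mxE; ring.
Qed.

Lemma cross_form_explicit a b A : cross_form a b A =
  (a i0 0 * b i1 0 - a i1 0 * b i0 0) * (A i2 i3 - A i3 i2)
  - (a i0 0 * b i2 0 - a i2 0 * b i0 0) * (A i1 i3 - A i3 i1)
  + (a i0 0 * b i3 0 - a i3 0 * b i0 0) * (A i1 i2 - A i2 i1)
  + (a i1 0 * b i2 0 - a i2 0 * b i1 0) * (A i0 i3 - A i3 i0)
  - (a i1 0 * b i3 0 - a i3 0 * b i1 0) * (A i0 i2 - A i2 i0)
  + (a i2 0 * b i3 0 - a i3 0 * b i2 0) * (A i0 i1 - A i1 i0).
Proof.
have E j k l : (col j A *m (delta_mx j (0 : 'I_1))^T) k l = A k j * (l == j)%:R.
  by rewrite mxE big_ord1 !mxE eqxx andbT.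
have AE : A = \sum_j col j A *m (delta_mx j (0 : 'I_1))^T.
  apply/matrixP => k l; rewrite summxE (bigD1 l) //= E eqxx mulr1 big1 ?addr0 // => j jl.
  by rewrite E eq_sym (negbTE jl) mulr0.
rewrite [in LHS]AE linear_sum sum_ord4 /= !cross_form_outer_explicit !E /=; ring.
Qed.

End CrossForm.

(** * Faces, affine parametrizations and pullbacks *)

Section Gram.
Variable R : realType.

Lemma dot_mulmx n (u v : 'cV[R]_n) : dot u v = (u^T *m v) 0 0.
Proof. by rewrite mxE; apply: eq_bigr => i _; rewrite mxE. Qed.

Lemma dotC n (u w : 'cV[R]_n) : dot u w = dot w u.
Proof. by apply: eq_bigr => i _; rewrite mulrC. Qed.

Lemma dot_eq0 n (u : 'cV[R]_n) : dot u u = 0 -> u = 0.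
Proof.
move=> /eqP; rewrite psumr_eq0 => [|i _]; last by rewrite -expr2 sqr_ge0.
move=> /allP H; apply/colP => i; rewrite mxE.
by have := H i (mem_index_enum _); rewrite mulf_eq0 orbb => /eqP.
Qed.

(** The squared length of E y is a value of the Gram form. *)
Lemma gram_neq0 n d (E : 'M[R]_(n, d)) :
  (forall y : 'cV_d, E *m y = 0 -> y = 0) -> \det (E^T *m E) != 0.
Proof.
move=> Einj; apply/det0P => -[v v0 vE]; case/negP: v0; apply/eqP.
apply: trmx_inj; rewrite trmx0; apply/Einj/dot_eq0.
by rewrite dot_mulmx trmx_mul trmxK -mulmxA [E^T *m _]mulmxA mulmxA vE mul0mx mxE.
Qed.

(** Orthonormal normals do not change the Gram determinant, so the surface measure
factor is the absolute value of the determinant of the completed frame. *)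
Lemma gram_orthonormal d e (E : 'M[R]_(d + e, d)) (N : 'M[R]_(d + e, e)) :
  E^T *m N = 0 -> N^T *m N = 1%:M -> \det (E^T *m E) = \det (row_mx E N) ^+ 2.
Proof.
move=> EN NN; rewrite expr2 -[X in _ = X * _]det_tr -det_mulmx.
rewrite tr_row_mx mul_col_row EN NN.
by rewrite det_lblock det1 mulr1.
Qed.

End Gram.

Section Faces.
Variable R : realType.
Implicit Types (S T : {set 'I_5}) (x u : 'cV[R]_4).

Definition face_origin S : 'cV[R]_4 := vtx R (nth ord0 (enum S) 0).
Definition face_edges d S : 'M[R]_(4, d) :=
  \matrix_(i, j) (vtx R (nth ord0 (enum S) (lift ord0 j)) - face_origin S) i 0.

Definition affine_hull S x := exists c : 'I_5 -> R,
  \sum_(i in S) c i = 1 /\ x = \sum_(i in S) c i *: vtx R i.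

Lemma face_integral_paramE d S g :
  face_integral d S g = Num.sqrt (\det ((face_edges d S)^T *m face_edges d S))
    * std_simplex_integral 1 (fun y => g (face_origin S + face_edges d S *m y)).
Proof. by []. Qed.

Lemma sum_face (V : nmodType) n S (f : 'I_5 -> V) : #|S| = n ->
  \sum_(i in S) f i = \sum_(j < n) f (nth ord0 (enum S) j).
Proof.
by move=> Sn; rewrite -big_enum (big_nth ord0) big_mkord -cardE Sn.
Qed.

Lemma face_comb d S (c : 'I_5 -> R) : #|S| = d.+1 ->
  \sum_(i in S) c i *: vtx R i = (\sum_(i in S) c i) *: face_origin S
    + face_edges d S *m (\col_j c (nth ord0 (enum S) (lift ord0 j))).
Proof.
move=> Sd; rewrite !(sum_face _ Sd) !big_ord_recl scalerDl -addrA; congr (_ + _).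
apply/colP => i; rewrite !mxE summxE mulr_suml -big_split; apply: eq_bigr => j _.
by rewrite !mxE /=; ring.
Qed.

Lemma face_coef d S (z : 'I_d.+1 -> R) : #|S| = d.+1 ->
  exists c : 'I_5 -> R, forall j : 'I_d.+1, c (nth ord0 (enum S) j) = z j.
Proof.
move=> Sd; exists (fun a => z (inord (index a (enum S)))) => j.
by rewrite index_uniq ?enum_uniq -?cardE ?Sd // inord_val.
Qed.

(** Coordinates on the face are barycentric coordinates with the first vertex left
out; the total weight c0 is 1 for points and 0 for tangent vectors. *)
Lemma face_coef_edges d S (c0 : R) (y : 'cV[R]_d) : #|S| = d.+1 ->
  exists c : 'I_5 -> R, [/\ \sum_(i in S) c i = c0,
    forall j : 'I_d, c (nth ord0 (enum S) (lift ord0 j)) = y j 0,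
    c (nth ord0 (enum S) 0) = c0 - \sum_j y j 0
    & \sum_(i in S) c i *: vtx R i = c0 *: face_origin S + face_edges d S *m y].
Proof.
move=> Sd.
pose z j := if unlift ord0 j is Some l then y l 0 else c0 - \sum_l y l 0.
have [c cz] := face_coef z Sd; exists c.
have c1 : c (nth ord0 (enum S) 0) = c0 - \sum_j y j 0.
  by rewrite (cz ord0) /z unlift_none.
have c2 (j : 'I_d) : c (nth ord0 (enum S) (lift ord0 j)) = y j 0.
  by rewrite cz /z liftK.
have c3 : \sum_(i in S) c i = c0.
  by rewrite (sum_face _ Sd) big_ord_recl c1 (eq_bigr _ (fun j _ => c2 j)) subrK.
split=> //; rewrite (face_comb _ Sd) c3; congr (_ + _ *m _).
by apply/colP => j; rewrite mxE c2.
Qed.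

Lemma tangentP d S u : #|S| = d.+1 ->
  tangent S u <-> exists y : 'cV[R]_d, u = face_edges d S *m y.
Proof.
move=> Sd; split=> [[c [c0 ->]]|[y ->]].
  by rewrite (face_comb _ Sd) c0 scale0r add0r; eexists.
have [c [c0 _ _ cE]] := face_coef_edges 0 y Sd.
by exists c; rewrite cE scale0r add0r.
Qed.

Lemma affine_hullP d S x : #|S| = d.+1 ->
  affine_hull S x <-> exists y : 'cV[R]_d, x = face_origin S + face_edges d S *m y.
Proof.
move=> Sd; split=> [[c [c1 ->]]|[y ->]].
  by rewrite (face_comb _ Sd) c1 scale1r; eexists.
have [c [c1 _ _ cE]] := face_coef_edges 1 y Sd.
by exists c; rewrite cE scale1r.
Qed.

Lemma vtx_free S (c : 'I_5 -> R) :
  \sum_(i in S) c i = 0 -> \sum_(i in S) c i *: vtx R i = 0 ->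
  forall i, i \in S -> c i = 0.
Proof.
move=> c0 cv.
have cj (j : 'I_4) : lift ord0 j \in S -> c (lift ord0 j) = 0.
  move=> jS; have /colP/(_ j) := cv; rewrite summxE mxE (bigD1 (lift ord0 j)) //=.
  rewrite !mxE eqxx mulr1 big1 ?addr0 // => i /andP[_ ij].
  rewrite !mxE; case: eqP => [iE|_]; last by rewrite mulr0.
  by case/eqP: ij; apply/val_inj.
move=> i iS; case: (unliftP ord0 i) iS => [j ->|-> i0S]; first exact: cj.
move: c0; rewrite (bigD1 ord0) //= big1 ?addr0 // => k /andP[kS k0].
by case: (unliftP ord0 k) kS k0 => [j ->|->] // /cj.
Qed.

Lemma face_edges_inj d S (y : 'cV[R]_d) : #|S| = d.+1 ->
  face_edges d S *m y = 0 -> y = 0.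
Proof.
move=> Sd Ey; have [c [c0 cy _ cE]] := face_coef_edges 0 y Sd.
rewrite scale0r add0r Ey in cE.
apply/colP => j; rewrite -cy mxE; apply: (vtx_free c0 cE).
by rewrite -mem_enum mem_nth // -cardE Sd.
Qed.

Lemma tangent_sub S T u : S \subset T -> tangent S u -> tangent T u.
Proof.
move=> /fintype.subsetP ST [c [c0 ->]]; exists (fun i => if i \in S then c i else 0).
have sumT (V : nmodType) (f : 'I_5 -> V) :
    \sum_(i in S) f i = \sum_(i in T) (if i \in S then f i else 0).
  rewrite -big_mkcondr; apply: eq_bigl => i.
  by case: (boolP (i \in S)) => [/ST ->|_]; rewrite ?andbF.
rewrite -[in LHS]sumT c0; split=> //; rewrite sumT; apply: eq_bigr => i _.
by case: ifP; rewrite ?scale0r.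
Qed.

End Faces.

Section Pullback.
Variables (R : realType).

Definition affine_tuple m n (x0 : 'cV[R]_m) (E : 'M[R]_(m, n)) :
    m.-tuple {mpoly R[n]} :=
  [tuple mpolyC n (x0 i 0) + \sum_j E i j *: 'X_j | i < m].

Lemma meval_affine m n (x0 : 'cV[R]_m) (E : 'M[R]_(m, n))
    (p : {mpoly R[m]}) (y : 'cV[R]_n) :
  meval (fun l => y l 0) (comp_mpoly (affine_tuple x0 E) p)
  = meval (fun i => (x0 + E *m y) i 0) p.
Proof.
rewrite comp_mpoly_meval; apply: meval_eq => i.
rewrite tnth_mktuple mevalD mevalC !mxE raddf_sum; congr (_ + _).
by apply: eq_bigr => j _; rewrite /= mevalZ mevalXU.
Qed.

Lemma msize_affine m n (x0 : 'cV[R]_m) (E : 'M[R]_(m, n)) (p : {mpoly R[m]}) k :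
  (msize p <= k)%N -> (msize (comp_mpoly (affine_tuple x0 E) p) <= k)%N.
Proof.
apply: msize_comp => i; rewrite tnth_mktuple; apply: msizeD_leq.
  by rewrite msizeC; case: (_ != 0).
apply: msize_sum_leq => j _; apply: msizeZ_leq.
by rewrite msizeX mdeg1.
Qed.

Implicit Types F : 'M[polyR4 R]_4.

Definition pullback n (x0 : 'cV[R]_4) (E : 'M[R]_(4, n)) F (i j : 'I_n) :
    {mpoly R[n]} :=
  \sum_a \sum_b (E a i * E b j) *: comp_mpoly (affine_tuple x0 E) (F a b).

Lemma meval_pullback n (x0 : 'cV[R]_4) (E : 'M[R]_(4, n)) F i j (y : 'cV[R]_n) :
  meval (fun l => y l 0) (pullback x0 E F i j)
  = (E^T *m ev F (x0 + E *m y) *m E) i j.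
Proof.
rewrite raddf_sum mxE /=.
under [RHS]eq_bigr => b _ do rewrite mxE mulr_suml.
rewrite exchange_big; apply: eq_bigr => a _.
rewrite raddf_sum; apply: eq_bigr => b _ /=.
by rewrite mevalZ meval_affine !mxE mulrAC.
Qed.

Lemma pullback_skew n (x0 : 'cV[R]_4) (E : 'M[R]_(4, n)) F :
  (forall i j, F i j = - F j i) ->
  forall i j, pullback x0 E F i j = - pullback x0 E F j i.
Proof.
move=> Fs i j; rewrite /pullback exchange_big -sumrN; apply: eq_bigr => a _.
rewrite -sumrN; apply: eq_bigr => b _.
by rewrite (Fs b a) raddfN scalerN mulrC.
Qed.

Lemma msize_pullback n (x0 : 'cV[R]_4) (E : 'M[R]_(4, n)) F k :
  (forall i j, msize (F i j) <= k)%N ->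
  forall i j, (msize (pullback x0 E F i j) <= k)%N.
Proof.
move=> Fk i j; apply: msize_sum_leq => a _; apply: msize_sum_leq => b _.
exact/msizeZ_leq/msize_affine.
Qed.

(** The position vector of the face coordinates is sent by E to x - x0, where x0
has degree 0; this is why the degree bound on the contraction survives an
affine substitution. *)
Lemma msize_pullback_trim n (x0 : 'cV[R]_4) (E : 'M[R]_(4, n)) F k :
  (forall i j, msize (F i j) <= k)%N ->
  (forall i, msize (\sum_j F i j * 'X_j) <= k)%N ->
  forall i, (msize (\sum_j pullback x0 E F i j * 'X_j) <= k)%N.
Proof.
move=> Fk Ftrim i; set ab := affine_tuple x0 E.
have -> : \sum_j pullback x0 E F i j * 'X_j = \sum_a E a i *:
    (comp_mpoly ab (\sum_b F a b * 'X_b) - \sum_b x0 b 0 *: comp_mpoly ab (F a b)).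
  under eq_bigr => j _ do rewrite mulr_suml.
  rewrite exchange_big; apply: eq_bigr => a _ /=.
  rewrite raddf_sum -sumrB scaler_sumr /=.
  under eq_bigr => j _ do rewrite mulr_suml.
  rewrite exchange_big; apply: eq_bigr => b _ /=.
  rewrite rmorphM /= comp_mpolyXU -tnth_nth tnth_mktuple mulrDr.
  rewrite -[X in _ = _ *: (_ * X + _ - _)]/(mpolyC n (x0 b 0)).
  rewrite [comp_mpoly ab _ * mpolyC _ _]mulrC mul_mpolyC addrAC subrr add0r.
  rewrite mulr_sumr scaler_sumr; apply: eq_bigr => j _.
  by rewrite -scalerAl -scalerAr scalerA.
apply: msize_sum_leq => a _; apply/msizeZ_leq/msizeB_leq.
  exact: msize_affine.
by apply: msize_sum_leq => b _; apply/msizeZ_leq/msize_affine.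
Qed.

End Pullback.

(** * Traces on faces, triangles *)

Section Traces.
Variable R : realType.
Implicit Types (S T : {set 'I_5}) (x u w : 'cV[R]_4) (F : 'M[polyR4 R]_4).

(** The trace is required to vanish on the whole affine hull, where a polynomial
identity holds as soon as it holds on the face. *)
Definition trace_free F S := forall x u w,
  affine_hull S x -> tangent S u -> tangent S w -> dot u (ev F x *m w) = 0.

Lemma edge_tangent d S (j : 'I_d) : #|S| = d.+1 -> tangent S (col j (face_edges R d S)).
Proof. by move=> Sd; apply/(tangentP _ Sd); exists (delta_mx j 0); rewrite colE. Qed.

Lemma meval_pullback_dot d x0 (E : 'M[R]_(4, d)) F i j (y : 'cV[R]_d) :
  meval (fun l => y l 0) (pullback x0 E F i j)
  = dot (col i E) (ev F (x0 + E *m y) *m col j E).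
Proof.
rewrite meval_pullback dot_mulmx tr_col rowE colE !mulmxA -colE -!mulmxA -rowE.
by rewrite [RHS]mxE [RHS]mxE.
Qed.

Lemma pullback_eq0_trace_free d S F : #|S| = d.+1 ->
  (forall i j, pullback (face_origin R S) (face_edges R d S) F i j = 0) ->
  trace_free F S.
Proof.
move=> Sd G0 x u w /(affine_hullP _ Sd)[y ->].
move=> /(tangentP _ Sd)[s ->] /(tangentP _ Sd)[t ->].
set A := ev _ _; have A0 : (face_edges R d S)^T *m A *m face_edges R d S = 0.
  by apply/matrixP => i j; rewrite -meval_pullback G0 raddf0 mxE.
by rewrite dot_mulmx trmx_mul -!mulmxA [_^T *m (A *m _)]mulmxA (mulmxA _ _ t) A0
  mul0mx mulmx0 mxE.
Qed.

(** Recognises the points (c0 = 1) and the directions (c0 = 0) of the face opposite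
to a vertex by their coordinates in S: the weight of that vertex must be 0. *)
Lemma face_comb_drop d S (c0 : R) (y : 'cV[R]_d) a : #|S| = d.+1 -> a \in S ->
  (exists2 j, a = nth ord0 (enum S) (lift ord0 j) & y j 0 = 0) \/
  (a = nth ord0 (enum S) 0 /\ \sum_j y j 0 = c0) ->
  exists c : 'I_5 -> R, \sum_(i in S :\ a) c i = c0 /\
    c0 *: face_origin R S + face_edges R d S *m y = \sum_(i in S :\ a) c i *: vtx R i.
Proof.
move=> Sd aS Ha; have [c [c1 cy cz cE]] := face_coef_edges c0 y Sd.
have ca : c a = 0.
  by case: Ha => [[j -> yj]|[-> ys]]; rewrite ?cy // cz ys subrr.
exists c; rewrite -cE -[in RHS]c1; split.
  by rewrite [RHS](big_setD1 a aS) /= ca add0r.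
by rewrite (big_setD1 a aS) /= ca scale0r add0r.
Qed.

Lemma vertex_in d S (j : 'I_d.+1) : #|S| = d.+1 -> nth ord0 (enum S) j \in S.
Proof. by move=> Sd; rewrite -mem_enum mem_nth // -cardE Sd. Qed.

(** The edges starting at the first vertex and avoiding the vertex l span the
directions of the face opposite to l. *)
Lemma edge_trace d S F (i j l : 'I_d) (y : 'cV[R]_d) : #|S| = d.+1 ->
  trace_free F (S :\ nth ord0 (enum S) (lift ord0 l)) ->
  i != l -> j != l -> y l 0 = 0 ->
  meval (fun m => y m 0) (pullback (face_origin R S) (face_edges R d S) F i j) = 0.
Proof.
move=> Sd tr0 il jl yl; rewrite meval_pullback_dot.
have aS := vertex_in (lift ord0 l) Sd.
have tg p : p != l ->
    tangent (S :\ nth ord0 (enum S) (lift ord0 l)) (col p (face_edges R d S)).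
  move=> pl; have [|c [c0 cE]] :=
    face_comb_drop (c0 := 0) (y := delta_mx p (0 : 'I_1)) Sd aS.
    by left; exists l => //; rewrite mxE eq_sym (negbTE pl).
  by exists c; rewrite c0 -cE scale0r add0r colE.
apply: tr0; [|exact: tg|exact: tg].
have [|c [c1 cE]] := face_comb_drop (c0 := 1) (y := y) Sd aS; first by left; exists l.
by exists c; rewrite c1 -cE scale1r.
Qed.

Lemma eq_opp_eq0 (T : lmodType R) (a : T) : a = - a -> a = 0.
Proof.
move=> /eqP; rewrite -subr_eq0 opprK -mulr2n -scaler_nat.
by rewrite scaler_eq0 pnatr_eq0 /= => /eqP.
Qed.

(** The three coefficients add up to the value of the form on two edges of the
face opposite to the first vertex, namely the differences of columns
j - i and l - i. *)
Lemma slant_trace d S F (i j l : 'I_d) (y : 'cV[R]_d) : #|S| = d.+1 ->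
  (forall a b, F a b = - F b a) ->
  trace_free F (S :\ nth ord0 (enum S) 0) -> \sum_m y m 0 = 1 ->
  let G := pullback (face_origin R S) (face_edges R d S) F in
  meval (fun m => y m 0) (G i j + G j l + G l i) = 0.
Proof.
move=> Sd Fs tr0 y1 G.
have aS := vertex_in ord0 Sd.
have tg p q : tangent (S :\ nth ord0 (enum S) 0)
    (col p (face_edges R d S) - col q (face_edges R d S)).
  have [|c [c0 cE]] := face_comb_drop (c0 := 0)
    (y := delta_mx p (0 : 'I_1) - delta_mx q (0 : 'I_1)) Sd aS.
    right; split=> //.
    under eq_bigr => m _ do rewrite !mxE !eqxx !andbT.
    rewrite sumrB (bigD1 p) //= eqxx big1 ?addr0; last by move=> m /negbTE ->.
    rewrite (bigD1 q) //= eqxx big1 ?addr0 ?subrr //; by move=> m /negbTE ->.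
  by exists c; rewrite c0 -cE scale0r add0r mulmxBr -!colE.
have := tr0 (face_origin R S + face_edges R d S *m y) _ _ _ (tg j i) (tg l i).
have af : affine_hull (S :\ nth ord0 (enum S) 0)
    (face_origin R S + face_edges R d S *m y).
  have [|c [c1 cE]] := face_comb_drop (c0 := 1) (y := y) Sd aS; first by right.
  by exists c; rewrite c1 -cE scale1r.
move=> /(_ af).
have dotBl u v w : dot (u - v) w = dot u w - dot v w :> R.
  by rewrite -sumrB; apply: eq_bigr => m _; rewrite !mxE mulrBl.
have dotBr u v w : dot u (v - w) = dot u v - dot u w :> R.
  by rewrite -sumrB; apply: eq_bigr => m _; rewrite !mxE mulrBr.
have Gii : G i i = 0.
  exact/eq_opp_eq0/pullback_skew.
rewrite mulmxBr dotBl !dotBr -!meval_pullback_dot -/G Gii raddf0 subr0 => <-.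
rewrite !mevalD /G (pullback_skew _ _ Fs i j) (pullback_skew _ _ Fs l i) !mevalN; ring.
Qed.
(** With p, q, r, s made of edge vectors of a face completed by unit normals, the
right-hand side only involves the pullback of A to that face. *)
Lemma cross_form_frame (p q r s a b : 'cV[R]_4) (A : 'M[R]_4)
    (v := fun i : 'I_4 => nth p [:: p; q; r; s] i) :
  \det (frame_mx p q r s) * cross_form a b A =
  cross_form (\col_i dot (v i) a) (\col_i dot (v i) b)
    (\matrix_(i, j) dot (v i) (A *m v j)).
Proof.
rewrite -det_tr -cross_form_mulmx trmxK.
have vE (i j : 'I_4) : frame_mx p q r s i j = v i j 0 by rewrite mxE.
congr cross_form.
- by apply/colP => i; rewrite !mxE; apply: eq_bigr => j _; rewrite vE.
- by apply/colP => i; rewrite !mxE; apply: eq_bigr => j _; rewrite vE.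
apply/matrixP => i j; rewrite -mulmxA !mxE; apply: eq_bigr => l _; rewrite vE.
congr (_ * _); rewrite !mxE; apply: eq_bigr => m _.
by rewrite mxE vE.
Qed.

Lemma unit_normal_edges d S n (j : 'I_d) : #|S| = d.+1 -> unit_normal S n ->
  dot (col j (face_edges R d S)) n = 0.
Proof.
by move=> Sd [_ nS]; rewrite dotC nS //; apply: edge_tangent.
Qed.

Lemma face_integral_moment d S (g : 'cV[R]_4 -> R) (p : {mpoly R[d]}) :
  0 < \det ((face_edges R d S)^T *m face_edges R d S) ->
  (forall y, g (face_origin R S + face_edges R d S *m y) = meval (fun l => y l 0) p) ->
  face_integral d S g = 0 -> moment d p = 0.
Proof.
move=> G0 gp /eqP; rewrite face_integral_paramE mulf_eq0 sqrtr_eq0 leNgt G0 /=.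
rewrite -std_simplex_integral_moment => /eqP <-.
by congr std_simplex_integral; apply/funext => y; rewrite gp.
Qed.

(** The left inverse of the parametrization whose kernel is the normal space of the
face; its transpose maps covectors in face coordinates to tangent vectors. *)
Definition face_coord d S : 'M[R]_(d, 4) :=
  invmx ((face_edges R d S)^T *m face_edges R d S) *m (face_edges R d S)^T.

Lemma face_coordK d S : #|S| = d.+1 -> face_coord d S *m face_edges R d S = 1%:M.
Proof.
move=> Sd; rewrite -mulmxA mulVmx // unitmxE unitfE.
by apply: gram_neq0 => y; exact: face_edges_inj.
Qed.

(** The ambient polynomial of the same degree that restricts to a given polynomial
in face coordinates. *)
Definition face_ext d S (q : {mpoly R[d]}) : polyR4 R :=
  comp_mpoly (affine_tuple (- (face_coord d S *m face_origin R S)) (face_coord d S)) q.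

Lemma meval_face_ext d S (q : {mpoly R[d]}) (y : 'cV[R]_d) : #|S| = d.+1 ->
  meval (fun l => (face_origin R S + face_edges R d S *m y) l 0) (face_ext S q)
  = meval (fun l => y l 0) q.
Proof.
move=> Sd; rewrite meval_affine; apply: meval_eq => i.
by rewrite mulmxDr mulmxA face_coordK // mul1mx addKr.
Qed.

(** Natural number subtraction is harmless: a negative degree forces p = 0. *)
Lemma in_P_msize (k c : nat) (p : polyR4 R) :
  (msize p <= k.+1 - c)%N -> in_P (k%:Z - c%:Z) p.
Proof.
have [->|p0] := eqVneq p 0; first by left.
have : (0 < msize p)%N by rewrite lt0n msize_poly_eq0.
by move=> m0 mk; right; lia.
Qed.

End Traces.

Lemma sum_ord2 (V : nmodType) (f : 'I_2 -> V) :
  \sum_i f i = f (@Ordinal 2 0 isT) + f (@Ordinal 2 1 isT).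
Proof.
rewrite !big_ord_recl big_ord0 addr0.
by congr (f _ + f _); apply/val_inj.
Qed.

Lemma ord2_ind (P : 'I_2 -> Prop) :
  P (@Ordinal 2 0 isT) -> P (@Ordinal 2 1 isT) -> forall i, P i.
Proof.
move=> P0 P1 [[|[|m]] mP] //.
- by rewrite (_ : Ordinal mP = @Ordinal 2 0 isT) //; apply/val_inj.
- by rewrite (_ : Ordinal mP = @Ordinal 2 1 isT) //; apply/val_inj.
Qed.

Section Triangle.
Variables (R : realType) (k : nat) (o : orientation R) (F : 'M[polyR4 R]_4).
Hypotheses (Fs : forall i j, F i j = - F j i)
  (Fk : forall i j, (msize (F i j) <= k.+1)%N)
  (Ftrim : forall i, (msize (\sum_j F i j * 'X_j) <= k.+1)%N).
Let j0 := @Ordinal 2 0 isT.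
Let j1 := @Ordinal 2 1 isT.

Lemma triangle_frame_det f n nu (E := face_edges R 2 f) : is_triangle f ->
  unit_normal f n -> unit_normal f nu -> dot n nu = 0 ->
  \det (E^T *m E) = \det (frame_mx (col j0 E) (col j1 E) nu n) ^+ 2.
Proof.
move=> f3 nU nuU nnu; pose N : 'M[R]_(2 + (1 + 1), 1 + 1) := row_mx nu n.
have EN u : unit_normal f u -> E^T *m u = 0.
  move=> uU; apply/colP => j; rewrite !mxE -[RHS](unit_normal_edges j f3 uU).
  by apply: eq_bigr => i _; rewrite !mxE.
have dotE (u w : 'cV[R]_4) : u^T *m w = (dot u w)%:M.
  by apply/matrixP => a b; rewrite !ord1 dot_mulmx [RHS]mxE eqxx mulr1n.
rewrite (@gram_orthonormal _ 2 (1 + 1) E N).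
- rewrite -[in RHS]det_tr; congr (\det _ ^+ 2); apply/matrixP => i j.
  rewrite !mxE; case: splitP => p jp.
    by elim/ord2_ind: p jp => /= ->; rewrite !mxE.
  rewrite !mxE; case: splitP => q; rewrite ord1 /= => pq.
    by rewrite jp pq.
  by rewrite jp pq.
- by rewrite /N mul_mx_row !EN // row_mx0.
rewrite /N tr_row_mx mul_col_row !dotE nU.1 nuU.1 nnu (dotC nu) nnu.
by rewrite (_ : 0%:M = 0) ?raddf0 // -scalar_mx_block.
Qed.

(** The contraction bound makes the single coefficient of the pullback a polynomial
of degree k - 1 instead of k, so it is its own test function. *)
Lemma triangle_trace_free f : is_triangle f ->
  (forall q : polyR4 R, in_P (k%:Z - 1) q ->
     face_integral 2 f (fun x => dot (cross (nrm o (fct o f)) (ev F x)) (conrm o f)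
            * meval (fun l => x l 0) q) = 0) ->
  trace_free F f.
Proof.
move=> f3 dof; set n := nrm o (fct o f) in dof *; set nu := conrm o f in dof *.
have [fF fsub] := fctP o f3; have [nn nT] := nrmP o fF; rewrite -/n in nn nT.
have [nuT nuU] := conrmP o f3; have nunu := nuU.1; rewrite -/nu in nuT nuU nunu.
have nU : unit_normal f n by split=> // u uf; apply: nT; apply: tangent_sub uf.
have nnu : dot n nu = 0 by apply: nT.
have nun : dot nu n = 0 by rewrite dotC.
set E := face_edges R 2 f.
have gramE := triangle_frame_det f3 nU nuU nnu; rewrite -/E in gramE.
set D := \det (frame_mx _ _ _ _) in gramE.
have gram0 : 0 < \det (E^T *m E).
  rewrite lt_def gram_neq0 ?gramE ?sqr_ge0 //.
  by move=> y; apply: face_edges_inj.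
have D0 : D != 0 by rewrite -sqrf_eq0 -gramE gt_eqF.
apply: (pullback_eq0_trace_free (d := 2)) => //.
rewrite -/E; set G := pullback _ _ F.
have Gs i j : G i j = - G j i by apply: pullback_skew.
have Gd i : G i i = 0 by apply/eq_opp_eq0/Gs.
have G01 : G j0 j1 = 0.
  (* the first entry of G(y) y is y_1 G_01 *)
  have Gk : (msize (G j0 j1) <= k)%N.
    apply: (@msizeMX_ge _ _ _ j1).
    have := msize_pullback_trim (face_origin R f) E Fk Ftrim j0.
    by rewrite sum_ord2 -/G -/j0 -/j1 Gd mul0r add0r mulrC.
  have crossE y : cross_form nu n (ev F (face_origin R f + E *m y)) =
      (2 / D) * meval (fun l => y l 0) (G j0 j1).
    apply: (mulfI D0); rewrite cross_form_frame cross_form_explicit !mxE /=.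
    rewrite !(unit_normal_edges _ f3 nuU) !(unit_normal_edges _ f3 nU).
    rewrite nunu nn nnu nun -!meval_pullback_dot -/G -/j0 -/j1.
    by rewrite (Gs j1) mevalN; field.
  have /eqP : moment 2 ((2 / D) *: (G j0 j1 * G j0 j1)) = 0.
    apply: (@face_integral_moment _ 2 f
      (fun x => cross_form nu n (ev F x)
        * meval (fun l => x l 0) (face_ext f (G j0 j1)))) => // [y|].
      by rewrite crossE meval_face_ext // mevalZ mevalM mulrA.
    apply: dof; apply: (@in_P_msize _ k 1); rewrite subn1 /=.
    exact: msize_affine.
  rewrite linearZ mulf_eq0 mulf_eq0 invr_eq0 (negbTE D0) pnatr_eq0 /= => /eqP m0.
  apply: (@moment_squares_eq0 R 2 unit (fun=> 1) (fun=> G j0 j1) _ _ tt).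
    by move=> _ x _; rewrite meval1.
  by rewrite big_const card_unit /= addr0 mul1r expr2.
by elim/ord2_ind=> [|]; elim/ord2_ind; rewrite -/j0 -/j1 ?Gd // ?G01 // Gs G01 oppr0.
Qed.
End Triangle.

(** * Facets and the interior *)

Lemma sum_ord3 (V : nmodType) (f : 'I_3 -> V) :
  \sum_i f i = f (@Ordinal 3 0 isT) + f (@Ordinal 3 1 isT) + f (@Ordinal 3 2 isT).
Proof.
rewrite !big_ord_recl big_ord0 addr0 addrA.
by congr (f _ + f _ + f _); apply/val_inj.
Qed.

Lemma ord3_ind (P : 'I_3 -> Prop) :
  P (@Ordinal 3 0 isT) -> P (@Ordinal 3 1 isT) -> P (@Ordinal 3 2 isT) -> forall i, P i.
Proof.
move=> P0 P1 P2 [[|[|[|m]]] mP] //.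
- by rewrite (_ : Ordinal mP = @Ordinal 3 0 isT) //; apply/val_inj.
- by rewrite (_ : Ordinal mP = @Ordinal 3 1 isT) //; apply/val_inj.
- by rewrite (_ : Ordinal mP = @Ordinal 3 2 isT) //; apply/val_inj.
Qed.

Section Facet.
Variables (R : realType) (k : nat) (o : orientation R) (F : 'M[polyR4 R]_4).
Hypotheses (Fs : forall i j, F i j = - F j i)
  (Fk : forall i j, (msize (F i j) <= k.+1)%N)
  (Ftrim : forall i, (msize (\sum_j F i j * 'X_j) <= k.+1)%N).
Let j0 := @Ordinal 3 0 isT.
Let j1 := @Ordinal 3 1 isT.
Let j2 := @Ordinal 3 2 isT.

Lemma facet_frame_det S n (E := face_edges R 3 S) : is_facet S -> unit_normal S n ->
  \det (E^T *m E) = \det (frame_mx (col j0 E) (col j1 E) (col j2 E) n) ^+ 2.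
Proof.
move=> S4 nU; rewrite (@gram_orthonormal _ 3 1 E n).
- rewrite -[in RHS]det_tr; congr (\det _ ^+ 2); apply/matrixP => i j.
  rewrite !mxE; case: splitP => p jp.
    by elim/ord3_ind: p jp => /= ->; rewrite !mxE.
  by rewrite jp ord1.
- apply/colP => j; rewrite !mxE -[RHS](unit_normal_edges j S4 nU).
  by apply: eq_bigr => i _; rewrite !mxE.
by apply/matrixP => a b; rewrite !ord1 -dot_mulmx nU.1 mxE eqxx.
Qed.

(** In face coordinates the dual of the pullback is a vector field to which
[flux_field_eq0] applies: the boundary conditions are the traces on the four
triangles of S. *)
Lemma facet_trace_free S : is_facet S ->
  (forall f, is_triangle f -> trace_free F f) ->
  (forall q : 'cV[polyR4 R]_4, (forall i, in_P (k%:Z - 2) (q i 0)) ->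
        (forall x, on_face S x -> tangent S (ev q x)) ->
        face_integral 3 S (fun x => dot (cross (nrm o S) (ev F x)) (ev q x)) = 0) ->
  trace_free F S.
Proof.
move=> S4 tri dof; set n := nrm o S in dof *; have nU := nrmP o S4; rewrite -/n in nU.
set E := face_edges R 3 S.
have gramE := facet_frame_det S4 nU; rewrite -/E in gramE.
set D := \det (frame_mx _ _ _ _) in gramE.
have gram0 : 0 < \det (E^T *m E).
  rewrite lt_def gram_neq0 ?gramE ?sqr_ge0 //.
  by move=> y; apply: face_edges_inj.
have D0 : D != 0 by rewrite -sqrf_eq0 -gramE gt_eqF.
have tri' j : trace_free F (S :\ nth ord0 (enum S) (j : 'I_4)).
  apply: tri; have := cardsD1 (nth ord0 (enum S) j) S.
  by rewrite S4 vertex_in // => -[].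
apply: (pullback_eq0_trace_free (d := 3)) => //.
rewrite -/E; set G := pullback _ _ F.
have Gs i j : G i j = - G j i by apply: pullback_skew.
have Gd i : G i i = 0 by apply/eq_opp_eq0/Gs.
(* the 2-form G seen as a vector field *)
pose g (i : 'I_3) := nth 0 [:: G j1 j2; G j2 j0; G j0 j1] i.
suff g0 i : g i = 0.
  have := (g0 j0, g0 j1, g0 j2); rewrite /g /=; case=> [[g12 g20] g01].
  by elim/ord3_ind=> [||]; elim/ord3_ind;
    rewrite -/j0 -/j1 -/j2 ?Gd // ?g12 ?g20 ?g01 //
    Gs ?g12 ?g20 ?g01 oppr0.
apply: (@flux_field_eq0 R 1 k g) i.
- have Gk i j : (msize (G i j) <= k.+1)%N by apply: msize_pullback.
  by elim/ord3_ind; rewrite /g /=.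
- have := msize_pullback_trim (face_origin R S) E Fk Ftrim; rewrite -/G => Gtrim.
  have := (Gtrim j0, Gtrim j1, Gtrim j2).
  rewrite !sum_ord3 -/j0 -/j1 -/j2 !Gd (Gs j1 j0) (Gs j0 j2) (Gs j2 j1) => -[[T0 T1] T2].
  have sgn p q : p = q \/ p = - q -> (msize p <= k.+1)%N -> (msize q <= k.+1)%N.
    by case=> ->; rewrite ?msizeN.
  move=> i j; elim/ord3_ind: i; elim/ord3_ind: j; rewrite /g /= -/j0 -/j1 -/j2.
  + by rewrite subrr msize0.
  + by apply: sgn T2; first [left; ring | right; ring].
  + by apply: sgn T1; first [left; ring | right; ring].
  + by apply: sgn T2; first [left; ring | right; ring].
  + by rewrite subrr msize0.
  + by apply: sgn T0; first [left; ring | right; ring].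
  + by apply: sgn T1; first [left; ring | right; ring].
  + by apply: sgn T0; first [left; ring | right; ring].
  + by rewrite subrr msize0.
- move=> i x xi; rewrite meval_col.
  have tr a b : a != i -> b != i -> meval (fun l => (\col_i x i) l 0) (G a b) = 0.
    by move=> ai bi; apply: (edge_trace (l := i)) => //; rewrite mxE.
  by elim/ord3_ind: i xi tr => _ tr; rewrite /g /=; apply: tr.
- move=> x x1.
  have x1' : \sum_m (\col_i x i) m 0 = 1 :> R.
    by rewrite -[RHS]x1; apply: eq_bigr => m _; rewrite mxE.
  have := slant_trace j0 j1 j2 S4 Fs (tri' ord0) x1'.
  rewrite /= -/E -/G -(meval_col x) sum_ord3 /g /= => H; rewrite -[RHS]H.
  by rewrite !mevalD -/j0 -/j1 -/j2; ring.
move=> eta etak.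
(* the tangent field whose covector in face coordinates is eta *)
pose q : 'cV[polyR4 R]_4 := \col_i \sum_j face_coord R 3 S j i *: face_ext S (eta j).
have evq x : ev q x = (face_coord R 3 S)^T *m
    \col_j meval (fun l => x l 0) (face_ext S (eta j)).
  apply/colP => i; rewrite !mxE raddf_sum; apply: eq_bigr => j _.
  by rewrite /= mevalZ !mxE.
have qP i : in_P (k%:Z - 2) (q i 0).
  apply: (@in_P_msize _ k 2); rewrite mxE subSS subn1; apply: msize_sum_leq => j _.
  exact/msizeZ_leq/msize_affine.
have qT x : tangent S (ev q x).
  apply/(tangentP _ S4); rewrite evq /face_coord trmx_mul trmxK -mulmxA.
  by eexists; reflexivity.
have crossE y (x := face_origin R S + E *m y) :
    cross_form (ev q x) n (ev F x) =
      (2 / D) * meval (fun l => y l 0) (\sum_i g i * eta i).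
  have dq j : dot (col j E) (ev q x) = meval (fun l => y l 0) (eta j).
    have -> : dot (col j E) (ev q x) = (E^T *m ev q x) j 0.
      by rewrite mxE; apply: eq_bigr => i _; rewrite !mxE.
    by rewrite evq mulmxA -trmx_mul face_coordK // trmx1 mul1mx mxE meval_face_ext.
  have nq : dot n (ev q x) = 0 by apply: nU.2.
  apply: (mulfI D0); rewrite cross_form_frame cross_form_explicit !mxE /= nq nU.1.
  rewrite !(unit_normal_edges _ S4 nU) -/E !dq -!meval_pullback_dot -/G -/j0 -/j1 -/j2.
  rewrite sum_ord3 /g /= !mevalD !mevalM (Gs j1 j0) (Gs j0 j2) (Gs j2 j1) !mevalN.
  by field.
have /eqP : moment 3 ((2 / D) *: (\sum_i g i * eta i)) = 0.
  apply: (@face_integral_moment _ 3 S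
      (fun x => cross_form (ev q x) n (ev F x))) => // [y|].
    by rewrite crossE mevalZ.
  by apply: dof => // x _.
by rewrite linearZ mulf_eq0 mulf_eq0 invr_eq0 (negbTE D0) pnatr_eq0 /= => /eqP.
Qed.

End Facet.

Section Volume.
Variables (R : realType) (k : nat) (F : 'M[polyR4 R]_4).
Hypotheses (Fs : forall i j, F i j = - F j i)
  (Fk : forall i j, (msize (F i j) <= k.+1)%N)
  (Ftrim : forall i, (msize (\sum_j F i j * 'X_j) <= k.+1)%N).

Lemma skewL_surj (A : zmodType) (Q : 'I_4 -> 'I_4 -> A) :
  (forall i j, Q i j = - Q j i) -> (forall i, Q i i = 0) ->
  exists q : 'rV[A]_6, (forall l, exists i j, q 0 l = Q i j) /\
    forall i j, skewL q i j = Q i j.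
Proof.
move=> Qs Qd.
pose I l := nth (i0, i0)
  [:: (i0, i1); (i0, i2); (i0, i3); (i1, i2); (i1, i3); (i2, i3)] l.
exists (\row_l Q (I l).1 (I l).2); split.
  by move=> l; rewrite mxE; exists (I l).1, (I l).2.
move=> i j; rewrite mxE; elim/ord4_ind: i; elim/ord4_ind: j;
  by rewrite /= ?mxE ?inordK //= /I /= ?Qd // Qs ?opprK.
Qed.

Lemma nth_enum_setT n (j : 'I_n.+1) : nth ord0 (enum [set: 'I_n.+1]) j = j.
Proof.
have -> : enum [set: 'I_n.+1] = enum 'I_n.+1 by apply: eq_enum => i; rewrite inE.
by rewrite nth_ord_enum.
Qed.

Lemma simplex_volume_pos :
  0 < \det ((face_edges R 4 [set: 'I_5])^T *m face_edges R 4 [set: 'I_5]).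
Proof.
have K5 : #|[set: 'I_5]| = 5%N by rewrite cardsT card_ord.
rewrite lt_def gram_neq0 => [|y]; last exact: face_edges_inj.
by rewrite det_mulmx det_tr -expr2 sqr_ge0.
Qed.

Lemma face_edges_simplex :
  face_edges R 4 [set: 'I_5] = 1%:M /\ face_origin R [set: 'I_5] = 0.
Proof.
have o0 : face_origin R [set: 'I_5] = 0.
  by apply/colP => i; rewrite /face_origin (nth_enum_setT ord0) !mxE.
split=> //; apply/matrixP => i j.
by rewrite mxE o0 subr0 nth_enum_setT !mxE /= eqSS eq_sym.
Qed.

Lemma trace_free_eq0 :
  (forall S, is_facet S -> trace_free F S) ->
  (forall q : 'rV[polyR4 R]_6, (forall i, in_P (k%:Z - 3) (q 0 i)) ->
        face_integral 4 [set: 'I_5] (fun x =>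
          ddot (ev F x) (ev (skewL q) x)) = 0) ->
  F = 0.
Proof.
move=> fac dof.
have K5 : #|[set: 'I_5]| = 5%N by rewrite cardsT card_ord.
have [E1 o0] := face_edges_simplex.
have fac' j : trace_free F ([set: 'I_5] :\ nth ord0 (enum [set: 'I_5]) (j : 'I_5)).
  apply: fac; have := cardsD1 (nth ord0 (enum [set: 'I_5]) j) [set: 'I_5].
  by rewrite K5 vertex_in // => -[].
have pullbackE (y : 'cV[R]_4) i j : meval (fun l => y l 0)
    (pullback (face_origin R [set: 'I_5]) (face_edges R 4 [set: 'I_5]) F i j)
    = meval (fun l => y l 0) (F i j).
  by rewrite meval_pullback E1 o0 trmx1 mul1mx mulmx1 add0r mul1mx mxE.
apply/matrixP => i j; rewrite mxE.
apply: (@bubble_form_eq0 R k F) i j => //.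
- move=> l i j x il jl xl; rewrite meval_col -pullbackE.
  by apply: (edge_trace (l := l)) => //; rewrite mxE.
- move=> i j l x x1; rewrite meval_col !mevalD -!pullbackE -!mevalD.
  apply: slant_trace => //; first exact: (fac' ord0).
  by rewrite -[RHS]x1; apply: eq_bigr => m _; rewrite mxE.
move=> Q Qs Qk.
have Qd i : Q i i = 0 by apply/eq_opp_eq0/Qs.
have [q [qQ qE]] := skewL_surj Qs Qd.
apply: (@face_integral_moment _ 4 [set: 'I_5]
   (fun x => ddot (ev F x) (ev (skewL q) x))) => [|y|].
- exact: simplex_volume_pos.
- rewrite E1 o0 mul1mx add0r raddf_sum; apply: eq_bigr => i _.
  rewrite raddf_sum; apply: eq_bigr => j _.
  by rewrite /= mevalM [ev F y i j]mxE [ev _ y i j]mxE qE.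
apply: dof => l; apply: (@in_P_msize _ k 3).
by have [i [j ->]] := qQ l; rewrite subSS subn2.
Qed.

End Volume.

(** * The theorem *)

Lemma skewL_skew (A : zmodType) (w : 'rV[A]_6) i j : skewL w i j = - skewL w j i.
Proof.
by rewrite !mxE; elim/ord4_ind: i; elim/ord4_ind: j; rewrite /= ?opprK ?oppr0.
Qed.

Lemma msize_skewL (R : realType) (w : 'rV[polyR4 R]_6) k :
  (forall l, msize (w 0%R l) <= k)%N -> forall i j, (msize (skewL w i j) <= k)%N.
Proof.
move=> wk i j; rewrite mxE; elim/ord4_ind: i; elim/ord4_ind: j;
by rewrite /= ?msizeN ?msize0 ?wk.
Qed.

(** A box inside K, enough to recognise the zero polynomial. *)
Lemma in_K_small (R : realType) (x : 'I_4 -> R) :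
  (forall i, 0 < x i < 4^-1) -> in_K (\col_i x i).
Proof.
move=> x01; have K5 : #|[set: 'I_5]| = 5%N by rewrite cardsT card_ord.
have [c [c1 cx c0 cE]] := face_coef_edges 1 (\col_i x i) K5.
have [E1 o0] := face_edges_simplex R; rewrite E1 o0 scaler0 add0r mul1mx in cE.
exists c; split=> // i.
rewrite -[i]nth_enum_setT.
case: (unliftP ord0 i) => [j|] ->.
  by rewrite cx mxE; case/andP: (x01 j) => /ltW.
rewrite c0 subr_ge0 sum_ord4 !mxE.
have := (x01 i0, x01 i1, x01 i2, x01 i3).
case=> [[[/andP[_ a0] /andP[_ a1]] /andP[_ a2]] /andP[_ a3]]; lra.
Qed.

Theorem theorem4p10 (R : realType) (k : nat) (hk : (1 <= k)%N)
    (o : orientation R) (F : 'M[polyR4 R]_4)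
    (hF : in_VkL2 k F) (hdof : dofs_vanish k o F) :
  F = 0.
Proof.
have [u [w [uP wP wx FE]]] := hF; have [dof2 dof3 dof4] := hdof.
have uk l : (msize (u 0%R l) <= k)%N.
  by case: (uP l) => [->|]; [rewrite msize0 | lia].
have wk l : (msize (w 0%R l) <= k.+1)%N.
  apply: msize_leP => m km; apply: (dhomog_nemf_coeff (wP l)).
  by rewrite neq_ltn km orbT.
have Fuw i j : F i j = skewL u i j + skewL w i j by rewrite FE [LHS]mxE.
have Fs i j : F i j = - F j i.
  by rewrite !Fuw skewL_skew [skewL w i j]skewL_skew opprD.
have Fk i j : (msize (F i j) <= k.+1)%N.
  rewrite Fuw; apply: msizeD_leq; apply: msize_skewL => // l.
  exact: leqW.
(* the contraction of w vanishes on K, hence as a polynomial *)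
have w0 i : \sum_j skewL w i j * 'X_j = 0.
  apply: (@meval_box_eq0 _ _ _ 4^-1) => [|x x01]; first by rewrite invr_gt0 ltr0n.
  have /colP/(_ i) := wx _ (in_K_small x01); rewrite mxE [RHS]mxE => <-.
  rewrite raddf_sum; apply: eq_bigr => j _ /=.
  rewrite mevalM mevalXU [ev _ _ _ _]mxE [(\col__ _) _ _]mxE; congr (_ * _).
  by apply: meval_eq => l; rewrite mxE.
have Ftrim i : (msize (\sum_j F i j * 'X_j) <= k.+1)%N.
  under eq_bigr => j _ do rewrite Fuw mulrDl.
  rewrite big_split /= w0 addr0; apply: msize_sum_leq => j _.
  by rewrite mulrC; apply/msizeMX_leq/msize_skewL.
have tri f : is_triangle f -> trace_free F f.
  by move=> f3; apply: (triangle_trace_free Fs Fk Ftrim f3 (dof2 f f3)).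
have fac S : is_facet S -> trace_free F S.
  by move=> S4; apply: (facet_trace_free Fs Fk Ftrim S4 tri (dof3 S S4)).
exact: (trace_free_eq0 Fs Fk Ftrim fac dof4).
Qed.
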